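(* Let $k,m\in\mathbb{N}=\{1,2,\dots\}$, let $\mathcal{O}_k$ be the complex orthogonal group of $V=\mathbb{C}^k$, let $\overline{V}=\mathbb{C}\oplus V$, and let $R_m\subset\mathrm{End}_{\mathbb{C}}(\overline{V}^{\otimes m})$ be the subalgebra generated by the action of $S_m$ and the endomorphisms $\varepsilon_1,\dots,\varepsilon_m$ and $\zeta_1,\dots,\zeta_{m-1}$ (all defined in the context). Then: (i) The linear span of the image of $\mathcal{O}_k$ in $\mathrm{End}_{\mathbb{C}}(\overline{V}^{\otimes m})$ coincides with the centralizer of $R_m$. (ii) The assignment $\gamma\mapsto\gamma$ for $\gamma\in S_m$, $u_{m,i}\mapsto\varepsilon_i$ for $i=1,\dots,m$, and $p_i\mapsto\zeta_i$ for $i=1,\dots,m-1$, defines an epimorphism of algebras $\Psi:\mathfrak{R}_m(k+1,1)\twoheadrightarrow R_m$, where $\mathfrak{R}_m(k+1,1)$ is the complex partial Brauer algebra with parameters $\delta=k+1$, $\delta'=1$. (iii) For $m\le k$ the epimorphism $\Psi$ is injective and hence bijective.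
   Context: $V=\mathbb{C}^k$ carries a non-degenerate symmetric $\mathbb{C}$-bilinear form with orthonormal basis $e_1,\dots,e_k$; $\mathcal{O}_k$ is the group of linear transformations of $V$ preserving this form. $\mathbb{C}$ is the trivial $\mathcal{O}_k$-module with basis $e_0=1$; $\overline{V}=\mathbb{C}\oplus V$ has basis $e_0,e_1,\dots,e_k$, and $\overline{V}^{\otimes m}$ is an $\mathcal{O}_k$-module via the diagonal action. $S_m$ acts on $\overline{V}^{\otimes m}$ by permuting tensor factors, $\gamma(v_1\otimes\cdots\otimes v_m)=v_{\gamma^{-1}(1)}\otimes\cdots\otimes v_{\gamma^{-1}(m)}$. Let $\varepsilon$ be the projection of $\overline{V}$ onto $\mathbb{C}e_0$ with kernel $V$, and $\varepsilon_i=\mathrm{id}^{\otimes(i-1)}\otimes\varepsilon\otimes\mathrm{id}^{\otimes(m-i)}$. For $i=1,\dots,m-1$, $\zeta_i$ sends $e_{j_1}\otimes\cdots\otimes e_{j_m}$ ($j_1,\dots,j_m\in\{0,\dots,k\}$) to $\delta_{j_i,j_{i+1}}\sum_{s=0}^k e_{j_1}\otimes\cdots\otimes e_{j_{i-1}}\otimes e_s\otimes e_s\otimes e_{j_{i+2}}\otimes\cdots\otimes e_{j_m}$ (Kronecker delta). Partial Brauer algebra. Let $\underline{m}=\{1,\dots,m\}$, $\underline{m}'=\{1',\dots,m'\}$, and let $\mathtt{R}_m$ be the set of all set partitions (diagrams) of $\underline{m}\sqcup\underline{m}'$ into parts of size $1$ (singletons) or $2$ (pair parts). For $d,d'\in\mathtt{R}_m$,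 let $d|d'$ be the graph obtained by identifying the vertex $i'$ of $d$ with the vertex $i$ of $d'$ for each $i$ (these $m$ vertices form the equator), with edges the pair parts of $d$ and of $d'$. Let $d\circ d'\in\mathtt{R}_m$ be the partition of (the vertices $\underline{m}$ of $d$) $\sqcup$ (the vertices $\underline{m}'$ of $d'$) whose parts are the nonempty intersections of connected components of $d|d'$ with this set. $\mathfrak{R}_m(\delta,\delta')$ is the $\mathbb{C}$-vector space with basis $\mathtt{R}_m$ and multiplication $dd'=\delta^{a}{\delta'}^{b}\,d\circ d'$, where $a$ is the number of closed loops contained in the equator and $b$ the number of open strings (paths, including isolated single vertices) contained in the equator. A permutation $\gamma\in S_m$ is identified with the diagram $\{\{\gamma(i),i'\}:i\in\underline{m}\}$. The diagram $u_{m,i}$ has parts $\{i\},\{i'\}$ and $\{j,j'\}$ for $j\ne i$. The diagram $p_i$ has parts $\{i,i+1\},\{i',(i+1)'\}$ and $\{j,j'\}$ for $j\neq i,i+1$. The algebra $\mathfrak{R}_m(\delta,\delta')$ is generated by $S_m$, the $u_{m,i}$ and the $p_i$. *)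

(* Defs.v *)
From HB Require Import structures.
From mathcomp Require Export all_boot all_order all_algebra all_fingroup all_field.
From mathcomp Require Export complex reals.
From mathcomp Require Import zify.

Set Implicit Arguments.
Unset Strict Implicit.
Unset Printing Implicit Defensive.

Import GRing.Theory.

(* Complex numbers are R[i] for R : realType; most of what follows makes sense
   over any field C. *)

Section TensorSpace.

Local Open Scope ring_scope.

Variables (C : fieldType) (k m : nat).

(* Vbar = C (+) V is the space of column vectors 'cV[C]_(1 + k): coordinate 0
   is the trivial summand, the last k coordinates are those of V in the
   orthonormal basis e_1, ..., e_k.  Its m-th tensor power is the space of
   families of coordinates with respect to the basis
   e_(J 0) (x) ... (x) e_(J (m - 1)), J ranging over the multi-indices. *)
Definition midx := {ffun 'I_m -> 'I_(1 + k)}.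

Definition tpow := {ffun midx -> C^o}.
HB.instance Definition _ := Vector.on tpow.

Definition pure (v : 'I_m -> 'cV[C]_(1 + k)) : tpow :=
  [ffun I : midx => \prod_i v i (I i) 0].

Definition ebasis (j : 'I_(1 + k)) : 'cV[C]_(1 + k) := delta_mx j 0.

Definition tbasis (J : midx) : tpow := pure (fun i => ebasis (J i)).

Lemma tbasisE J I : tbasis J I = (I == J)%:R.
Proof.
rewrite ffunE; under eq_bigr do rewrite mxE andbT.
have [->|/eqP nIJ] := eqVneq I J; first by rewrite big1 // => i; rewrite eqxx.
have [i nIJi] : exists i, I i != J i.
  apply/existsP; apply: contra_notT nIJ => /existsPn eIJ.
  by apply/ffunP => i; apply/eqP; have := eIJ i; rewrite negbK.
by rewrite (bigD1 i) //= (negbTE nIJi) mul0r.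
Qed.

Lemma tpow_sum (x : tpow) : x = \sum_J x J *: tbasis J.
Proof.
apply/ffunP => I; rewrite sum_ffunE (bigD1 I) //= ffunE tbasisE eqxx.
rewrite [_ *: _]mulr1 big1 ?addr0 // => J nJI.
by rewrite ffunE tbasisE eq_sym (negbTE nJI) [_ *: _]mulr0.
Qed.

Definition tend := 'End(tpow).
HB.instance Definition _ := Vector.on tend.

Fact tend1_neq0 : \1%VF != 0 :> tend.
Proof.
apply/eqP => /lfunP/(_ (tbasis [ffun=> ord0]))/ffunP/(_ [ffun=> ord0]).
rewrite !lfunE /= tbasisE eqxx ffunE => /eqP.
by rewrite oner_eq0.
Qed.

(* The product of tend is the usual composition (f * g) x = f (g x). *)
HB.instance Definition _ := GRing.Zmodule_isNzRing.Build tend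
  (@comp_lfunA _ _ _ _ _) (@comp_lfun1l _ _ _) (@comp_lfun1r _ _ _)
  (@comp_lfunDl _ _ _ _) (@comp_lfunDr _ _ _ _) tend1_neq0.
HB.instance Definition _ := GRing.Lmodule_isLalgebra.Build C tend
  (fun a f g => comp_lfunZl a f g).
HB.instance Definition _ := GRing.Lalgebra_isAlgebra.Build C tend
  (fun a f g => comp_lfunZr a f g).
HB.instance Definition _ := Algebra_isFalgebra.Build C tend.

Lemma tendM (f g : tend) x : (f * g) x = f (g x).
Proof. exact: comp_lfunE. Qed.

Lemma tend1 x : (1 : tend) x = x.
Proof. exact: id_lfunE. Qed.

Definition text_fun (F : midx -> tpow) (x : tpow) : tpow :=
  \sum_J x J *: F J.

Fact text_fun_is_linear F : linear (text_fun F).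
Proof.
move=> a x y; rewrite /text_fun scaler_sumr -big_split /=.
by apply: eq_bigr => J _; rewrite !ffunE scalerDl scalerA.
Qed.
HB.instance Definition _ F :=
  GRing.isLinear.Build C tpow tpow _ (text_fun F) (text_fun_is_linear F).

(* The endomorphism sending tbasis J to F J. *)
Definition text (F : midx -> tpow) : tend := linfun (text_fun F).

Lemma textE F x : text F x = \sum_J x J *: F J.
Proof. exact: lfunE. Qed.

Lemma text_basis F J : text F (tbasis J) = F J.
Proof.
rewrite textE (bigD1 J) //= tbasisE eqxx scale1r big1 ?addr0 // => I nIJ.
by rewrite tbasisE (negbTE nIJ) scale0r.
Qed.

(* A 0 (x) ... (x) A (m - 1) *)
Definition tmap (A : 'I_m -> 'M[C]_(1 + k)) : tend :=
  text (fun J => pure (fun i => A i *m ebasis (J i))).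

Lemma tmap_pure A v : tmap A (pure v) = pure (fun i => A i *m v i).
Proof.
rewrite textE; apply/ffunP => I; rewrite sum_ffunE ffunE.
under [RHS]eq_bigr do rewrite mxE.
rewrite bigA_distr_bigA /=; apply: eq_bigr => J _.
rewrite !ffunE [_ *: _]mulrC -big_split /=; apply: eq_bigr => i _.
by rewrite -colE mxE.
Qed.

Definition form (u v : 'cV[C]_k) : C := \sum_i u i 0 * v i 0.

Definition orthogonal (g : 'M[C]_k) : Prop :=
  forall u v : 'cV[C]_k, form (g *m u) (g *m v) = form u v.

Definition Oact (g : 'M[C]_k) : tend := tmap (fun=> block_mx 1%:M 0 0 g).

Definition in_Ospan (f : tend) : Prop :=
  exists (n : nat) (a : 'I_n -> C) (g : 'I_n -> 'M[C]_k),
    (forall i, orthogonal (g i)) /\ f = \sum_i a i *: Oact (g i).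

(* Beware that the product s * t of 'S_m applies s first; the values s i are
   used directly, so that Sact (s * t)%g = Sact t * Sact s, as for the usual
   left action of functions composed from right to left. *)
Definition Sact (s : 'S_m) : tend :=
  text (fun J => pure (fun i => ebasis (J ((s^-1)%g i)))).

Lemma Sact_pure s v : Sact s (pure v) = pure (fun i => v ((s^-1)%g i)).
Proof.
rewrite textE; apply/ffunP => I; rewrite sum_ffunE ffunE.
pose I' : midx := [ffun i => I (s i)].
rewrite (bigD1 I') //= big1 => [|J nJ]; rewrite !ffunE.
  rewrite addr0 [X in _ *: X]big1 => [|i _]; last first.
    by rewrite mxE ffunE permKV !eqxx.
  rewrite [_ *: _]mulr1 (reindex_inj (@perm_inj _ (s^-1)%g)) /=.
  by apply: eq_bigr => i _; rewrite ffunE permKV.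
have -> : \prod_i ebasis (J ((s^-1)%g i)) (I i) 0 = tbasis J I'.
  rewrite ffunE (reindex_inj (@perm_inj _ s)) /=.
  by apply: eq_bigr => i _; rewrite permK ffunE.
by rewrite tbasisE eq_sym (negbTE nJ) [_ *: _]mulr0.
Qed.

Definition eps (i : 'I_m) : tend :=
  tmap (fun l => if l == i then block_mx 1%:M 0 0 0 else 1%:M).

(* The endomorphism zeta_i of two adjacent factors i and j = i + 1. *)
Definition zeta (i j : 'I_m) : tend :=
  text (fun J => (J i == J j)%:R *: \sum_(s < 1 + k)
    pure (fun l => ebasis (if (l == i) || (l == j) then s else J l))).

Definition Rgens : seq tend :=
  [seq Sact s | s : 'S_m] ++ [seq eps i | i : 'I_m] ++
  [seq zeta p.1 p.2 | p : 'I_m * 'I_m <- enum {: 'I_m * 'I_m} & p.1.+1 == p.2 :> nat].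

(* <<Rgens>>%VS is the linear span, <<_>>%AS the unital subalgebra that it
   generates. *)
Definition Ralg : {aspace tend} := <<<<Rgens>>%VS>>%AS.

End TensorSpace.

(* A connected graph whose edges are the union of two matchings e1 and e2 has
   at most two vertices of degree at most 1. *)
Section TwoEnds.

Variable T : finType.
Implicit Types e : rel T.

Definition functional e := forall x y z, e x y -> e x z -> y = z.

Definition swap e x := odflt x [pick y | e x y].

Lemma swapE e x y : functional e -> e x y -> swap e x = y.
Proof.
rewrite /swap => fe exy; case: pickP => [z exz|/(_ y)]; first exact: fe exz exy.
by rewrite exy.
Qed.

Lemma swap_id e x : (forall y, ~~ e x y) -> swap e x = x.
Proof. by rewrite /swap => nex; case: pickP => // y; rewrite (negbTE (nex y)). Qed.

Lemma swapK e : symmetric e -> functional e -> involutive (swap e).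
Proof.
move=> se fe x; rewrite {2}/swap; case: pickP => [y exy|nex] /=.
  by apply: swapE => //; rewrite se.
by rewrite swap_id // => y; rewrite nex.
Qed.

Lemma two_ends e1 e2 x y z :
  symmetric e1 -> functional e1 -> symmetric e2 -> functional e2 ->
  (forall t, t \in [:: x; y; z] ->
     (forall u, ~~ e1 t u) \/ (forall u, ~~ e2 t u)) ->
  connect [rel u v | e1 u v || e2 u v] x y ->
  connect [rel u v | e1 u v || e2 u v] x z ->
  y != x -> z != x -> y = z.
Proof.
wlog : e1 e2 / forall u, ~~ e2 x u => [wh|nx].
  move=> s1 f1 s2 f2 ends cy cz.
  have [|nx|nx] := ends x; rewrite ?inE ?eqxx //; last exact: (wh e1 e2).
  have eqc : connect [rel u v | e1 u v || e2 u v] =2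
             connect [rel u v | e2 u v || e1 u v].
    by apply: eq_connect => u v /=; rewrite orbC.
  apply: (wh e2 e1) => //; rewrite -?eqc // => t /ends; tauto.
move=> s1 f1 s2 f2 ends; set c := connect _.
pose r := swap e1 \o swap e2.
have K1 := swapK s1 f1; have K2 := swapK s2 f2.
have rI : injective r by apply: inj_comp; apply: inv_inj.
have tx : swap e2 x = x by apply: swap_id.
have rt n : iter n r (swap e2 (iter n r x)) = x.
  elim: n => [|n IHn] //; rewrite -[RHS]IHn iterSr; congr (iter n r _).
  by rewrite /= /r /= !(K1, K2).
have cE t : c x t -> exists2 n, (n < fingraph.order r x)%N & t = iter n r x.
  move=> cxt; suff : fconnect r x t.
    by move=> rxt; exists (findex r x t); rewrite ?findex_max ?iter_findex.
  case/connectP: cxt => p; elim/last_ind: p t => [|p u IHp] t /=.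
    by move=> _ ->.
  rewrite rcons_path last_rcons => /andP[pp eu] ->{t}.
  have := IHp _ pp erefl; move: eu; set w := last x p => eu rxw.
  have rtw : fconnect r x (swap e2 w).
    have e := rt (findex r x w); rewrite iter_findex // in e.
    by rewrite (fconnect_sym rI) -[X in fconnect _ _ X]e fconnect_iter.
  case/orP: eu => [/(swapE f1)|/(swapE f2)] <- //.
  rewrite -[X in swap e1 X]K2; apply: connect_trans rtw _.
  exact: (fconnect1 r).
have fixE n t : t \in [:: x; y; z] -> t != x -> (n < fingraph.order r x)%N ->
    t = iter n r x -> (n.*2 == fingraph.order r x) || (n.*2.-1 == fingraph.order r x).
  move=> tE tNx nN tn.
  have per a : (0 < a)%N -> (a < (fingraph.order r x).*2)%N ->
      iter a r x = x -> a = fingraph.order r x.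
    move=> a0 aN ax; have [aleN|Nlea] := ltnP a (fingraph.order r x).
      by have := findex_iter aleN; rewrite ax findex0; lia.
    have aN' : (a - fingraph.order r x < fingraph.order r x)%N by lia.
    have ax' : iter (a - fingraph.order r x) r x = x.
      by rewrite -[X in iter _ r X](iter_order rI) -iterD subnK.
    by have := findex_iter aN'; rewrite ax' findex0; lia.
  have n0 : (0 < n)%N by case: n tn {nN} => // tx0; rewrite tx0 eqxx in tNx.
  have [nt|nt] := ends t tE; last first.
    apply/orP; left; apply/eqP; apply: per; [lia|lia|].
    by rewrite -addnn iterD -tn -{1}(swap_id nt) tn rt.
  apply/orP; right; apply/eqP; apply: per; [lia|lia|].
  have -> : n.*2.-1 = (n + n.-1)%N by lia.
  rewrite iterD -[RHS](rt n); congr (iter n r _).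
  rewrite -tn -{1}(swap_id nt) tn -[in RHS](prednK n0) /= /r /= -/r.
  by rewrite ?(K1, K2).
move=> /cE[a aN ya] /cE[b bN zb] yx zx.
have := fixE a y; have := fixE b z; rewrite !inE !eqxx !orbT.
move=> /(_ isT zx bN zb) zN /(_ isT yx aN ya) yN; rewrite ya zb.
suff -> : a = b by [].
lia.
Qed.

End TwoEnds.

Section Diagrams.

Variable m : nat.

(* inl i is the vertex i of the upper row, inr i the vertex i' of the lower
   row. *)
Definition vert := ('I_m + 'I_m)%type.
HB.instance Definition _ := Finite.on vert.

Definition is_diagram (P : {set {set vert}}) : bool :=
  partition P [set: vert] && [forall A in P, #|A| <= 2].

Lemma is_diagramI (f : vert -> {set vert}) (P : {set {set vert}}) :
  (forall v, v \in f v) -> (forall v, f v \in P) ->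
  (forall A v, A \in P -> v \in A -> A = f v) ->
  (forall A, A \in P -> A != set0 /\ #|A| <= 2) -> is_diagram P.
Proof.
move=> vf fP Pf szP; apply/andP; split; last first.
  by apply/forall_inP => A /szP[].
apply/and3P; split.
- by apply/eqP/setP => v; rewrite inE; apply/bigcupP; exists (f v).
- apply/trivIsetP => A B PA PB; apply: contraNT => /pred0Pn[v /andP[Av Bv]].
  by rewrite (Pf A v) // (Pf B v).
- by apply/negP => /szP[]; rewrite eqxx.
Qed.

Definition diagram := {P : {set {set vert}} | is_diagram P}.
HB.instance Definition _ := SubFinite.on diagram.

Implicit Types d : diagram.

Lemma diagram_eq d A B v :
  A \in val d -> B \in val d -> v \in A -> v \in B -> A = B.
Proof.
case: d => P /= /andP[/and3P[_ /trivIsetP trP _] _] PA PB Av Bv.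
apply/eqP; apply: contraTT isT => /(trP _ _ PA PB)/pred0P/(_ v) /=.
by rewrite Av Bv.
Qed.

(* The vertices of the graph d|d': upper row, equator, lower row. *)
Definition vert3 := ('I_m + 'I_m + 'I_m)%type.
HB.instance Definition _ := Finite.on vert3.

Definition top_vert (v : vert) : vert3 := inl v.

Definition bot_vert (v : vert) : vert3 :=
  match v with inl i => inl (inr i) | inr i => inr i end.

Definition out_vert (v : vert) : vert3 :=
  match v with inl i => inl (inl i) | inr i => inr i end.

Definition equator : {set vert3} := [set inl (inr i) | i : 'I_m].

Lemma top_vert_inj : injective top_vert.
Proof. by move=> u v []. Qed.

Lemma bot_vert_inj : injective bot_vert.
Proof. by case=> i [] j //= [->]. Qed.

Lemma out_vert_inj : injective out_vert.
Proof. by case=> i [] j //= [->]. Qed.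

Definition edge (h : vert -> vert3) d : rel vert3 := fun x y =>
  [exists A in val d, (#|A| == 2) && ([set x; y] == h @: A)].

Definition adj d d' : rel vert3 := fun x y =>
  edge top_vert d x y || edge bot_vert d' x y.

Lemma edge_sym h d : symmetric (edge h d).
Proof. by move=> x y; rewrite /edge setUC. Qed.

Lemma edge_functional h d : injective h -> functional (edge h d).
Proof.
move=> hI x y z /exists_inP[A dA /andP[/eqP A2 /eqP xyA]].
case/exists_inP => B dB /andP[_ /eqP xzB].
have : x \in h @: A by rewrite -xyA set21.
case/imsetP => u Au xu.
have : x \in h @: B by rewrite -xzB set21.
case/imsetP => v Bv xv; have uv : u = v by apply: hI; rewrite -xu.
rewrite -uv in Bv.
have AB := diagram_eq dA dB Au Bv; rewrite AB -xzB in xyA.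
have : #|[set x; z]| = 2 by rewrite xzB -AB card_imset.
have /setP/(_ y) := xyA; rewrite !inE eqxx orbT => /esym/orP[/eqP yx|/eqP//].
by rewrite -xyA yx setUid cards1.
Qed.

Lemma edge_ex h d x y : edge h d x y -> exists u, x = h u.
Proof.
case/exists_inP => A _ /andP[_ /eqP xyA].
have : x \in h @: A by rewrite -xyA set21.
by case/imsetP => u _ ->; exists u.
Qed.

Lemma adj_sym d d' : symmetric (adj d d').
Proof.
by move=> x y; rewrite /adj (edge_sym top_vert) (edge_sym bot_vert).
Qed.

Definition components d d' : {set {set vert3}} :=
  [set [set y | connect (adj d d') x y] | x : vert3].

Definition comp_parts d d' : {set {set vert}} :=
  [set out_vert @^-1: K | K : {set vert3} in components d d'] :\ set0.

Fact comp_is_diagram d d' : is_diagram (comp_parts d d').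
Proof.
have cs : connect_sym (adj d d') by apply/sym_connect_sym/adj_sym.
pose f v := out_vert @^-1: [set y | connect (adj d d') (out_vert v) y].
have fv v : v \in f v by rewrite !inE connect0.
apply: (is_diagramI (f := f)) => // [v|A v|A].
- rewrite in_setD1; apply/andP; split.
    by apply: contraTneq (fv v) => ->; rewrite inE.
  by apply/imset_f/imset_f.
- rewrite in_setD1 => /andP[_ /imsetP[_ /imsetP[x _ ->] ->]].
  rewrite !inE => xv.
  by apply/setP => w; rewrite !inE (same_connect cs xv).
rewrite in_setD1 => /andP[nA0 /imsetP[_ /imsetP[x _ ->] AE]]; split=> //.
rewrite leqNgt; apply/negP => /card_gt2P[a [b [c [[]]]]].
rewrite AE !inE (cs x) => xa xb xc [ab bc ca]; move/negP: bc; apply; apply/eqP.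
apply/out_vert_inj/(@two_ends _ (edge top_vert d) (edge bot_vert d')
  (out_vert a)); rewrite ?(inj_eq out_vert_inj) 1?eq_sym //.
- exact: edge_sym.
- exact: (edge_functional top_vert_inj).
- exact: edge_sym.
- exact: (edge_functional bot_vert_inj).
- suff ends v : (forall u, ~~ edge top_vert d (out_vert v) u) \/
                (forall u, ~~ edge bot_vert d' (out_vert v) u).
    by move=> t; rewrite !inE => /or3P[] /eqP->.
  case: v => i; [right|left] => u; apply/negP => /edge_ex[[] w] //.
- exact: connect_trans xa xb.
- exact: connect_trans xa xc.
- by rewrite eq_sym.
Qed.

Definition comp d d' : diagram := exist [eta is_diagram] _ (comp_is_diagram d d').

Definition in_pair d (v : vert) : bool :=
  [exists A in val d, (v \in A) && (#|A| == 2)].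

(* A connected component inside the equator is a closed loop when all its
   vertices have degree 2, and an open string otherwise.  Degrees are counted
   with multiplicity: when {i', j'} is a part of d and {i, j} is a part of d',
   the vertices i and j of the equator form a closed loop of length 2. *)
Definition is_loop d d' (K : {set vert3}) : bool :=
  [forall i : 'I_m, (inl (inr i) \in K) ==>
    in_pair d (inr i) && in_pair d' (inl i)].

Definition nb_loops d d' : nat :=
  #|[set K in components d d' | (K \subset equator) && is_loop d d' K]|.

Definition nb_strings d d' : nat :=
  #|[set K in components d d' | (K \subset equator) && ~~ is_loop d d' K]|.

Definition perm_parts (s : 'S_m) : {set {set vert}} :=
  [set [set inl (s i); inr i] | i : 'I_m].

Definition u_parts (i : 'I_m) : {set {set vert}} :=
  [set [set inl i]; [set inr i]] :|:
  [set [set inl l; inr l] | l : 'I_m & l != i].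

Definition p_parts (i j : 'I_m) : {set {set vert}} :=
  [set [set inl i; inl j]; [set inr i; inr j]] :|:
  [set [set inl l; inr l] | l : 'I_m & (l != i) && (l != j)].

Lemma set1_size (v : vert) : [set v] != set0 /\ #|[set v]| <= 2.
Proof. by rewrite -card_gt0 cards1. Qed.

Lemma set2_size (u v : vert) : [set u; v] != set0 /\ #|[set u; v]| <= 2.
Proof. by rewrite -card_gt0 cards2; case: eqP. Qed.

Fact perm_is_diagram s : is_diagram (perm_parts s).
Proof.
pose f (v : vert) : {set vert} :=
  match v with inl l => [set inl l; inr ((s^-1)%g l)]
             | inr l => [set inl (s l); inr l] end.
apply: (is_diagramI (f := f)).
- by case=> l; rewrite !inE eqxx ?orbT.
- case=> l /=; last exact: imset_f.
  by apply/imsetP; exists ((s^-1)%g l); rewrite ?permKV.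
- move=> _ [] l /imsetP[a _ ->]; rewrite !inE ?orbF => /eqP[->] //=.
  by rewrite permK.
- by move=> _ /imsetP[i _ ->]; apply: set2_size.
Qed.

Fact u_is_diagram i : is_diagram (u_parts i).
Proof.
pose f (v : vert) : {set vert} :=
  match v with inl l | inr l =>
    if l == i then [set v] else [set inl l; inr l] end.
apply: (is_diagramI (f := f)).
- by case=> l /=; case: eqP; rewrite !inE eqxx ?orbT.
- case=> l /=; have [->|li] := eqVneq l i;
    rewrite in_setU in_set2 ?eqxx ?orbT //;
    by apply/orP; right; apply/imsetP; exists l; rewrite ?inE.
- move=> A v; rewrite in_setU in_set2 => /orP[/orP[]/eqP->|].
  + by rewrite inE => /eqP->; rewrite /= eqxx.
  + by rewrite inE => /eqP->; rewrite /= eqxx.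
  + case/imsetP => a; rewrite inE => /negbTE ai ->.
    by rewrite in_set2 => /orP[]/eqP->; rewrite /= ai.
- move=> A; rewrite in_setU in_set2 => /orP[/orP[]/eqP->|/imsetP[l _ ->]];
    by [apply: set1_size | apply: set2_size].
Qed.

Fact p_is_diagram i j : is_diagram (p_parts i j).
Proof.
pose f (v : vert) : {set vert} :=
  match v with
  | inl l => if (l == i) || (l == j) then [set inl i; inl j]
             else [set inl l; inr l]
  | inr l => if (l == i) || (l == j) then [set inr i; inr j]
             else [set inl l; inr l]
  end.
apply: (is_diagramI (f := f)).
- by case=> l /=; case: ifP => [/orP[]/eqP->|_]; rewrite !inE eqxx ?orbT.
- case=> l /=; case: ifPn => [_|lij]; rewrite in_setU in_set2 ?eqxx ?orbT //;
    by apply/orP; right; apply/imsetP; exists l; rewrite ?inE -?negb_or.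
- move=> A v; rewrite in_setU in_set2 => /orP[/orP[]/eqP->|].
  + by rewrite in_set2 => /orP[]/eqP->; rewrite /= eqxx ?orbT.
  + by rewrite in_set2 => /orP[]/eqP->; rewrite /= eqxx ?orbT.
  + case/imsetP => a; rewrite inE -negb_or => /negbTE aij ->.
    by rewrite in_set2 => /orP[]/eqP->; rewrite /= aij.
- move=> A; rewrite in_setU in_set2 => /orP[/orP[]/eqP->|/imsetP[l _ ->]];
    exact: set2_size.
Qed.

Definition perm_diag (s : 'S_m) : diagram := exist [eta is_diagram] _ (perm_is_diagram s).
Definition u_diag (i : 'I_m) : diagram := exist [eta is_diagram] _ (u_is_diagram i).
Definition p_diag (i j : 'I_m) : diagram := exist [eta is_diagram] _ (p_is_diagram i j).

End Diagrams.

Section PartialBrauer.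

Local Open Scope ring_scope.

Variables (C : fieldType) (m : nat).

Definition pbrauer := {ffun diagram m -> C^o}.
HB.instance Definition _ := Vector.on pbrauer.

Definition pbasis (d : diagram m) : pbrauer := [ffun d' => (d' == d)%:R].

(* The multiplication with parameters delta and delta'. *)
Definition pbmul (delta delta' : C) (x y : pbrauer) : pbrauer :=
  \sum_d \sum_d' (x d * y d' *
    (delta ^+ nb_loops d d' * delta' ^+ nb_strings d d')) *: pbasis (comp d d').

Definition pbone : pbrauer := pbasis (perm_diag 1%g).

Lemma pbmul_basis delta delta' d d' :
  pbmul delta delta' (pbasis d) (pbasis d') =
  (delta ^+ nb_loops d d' * delta' ^+ nb_strings d d') *: pbasis (comp d d').
Proof.
rewrite /pbmul (bigD1 d) //= [X in _ + X]big1 ?addr0 => [|e ned]; last first.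
  by apply: big1 => e' _; rewrite ffunE (negbTE ned) !mul0r scale0r.
rewrite (bigD1 d') //= [X in _ + X]big1 ?addr0 => [|e ned].
  by rewrite !ffunE !eqxx !mul1r.
by rewrite [pbasis d' e]ffunE (negbTE ned) mulr0 mul0r scale0r.
Qed.

(* Homomorphisms of unital algebras from the partial Brauer algebra with
   parameters delta, delta' to an algebra A. *)
Definition pb_hom (delta delta' : C) (A : falgType C) (F : 'Hom(pbrauer, A)) :=
  F pbone = 1 /\ forall x y, F (pbmul delta delta' x y) = F x * F y.

Definition Psi_on_generators (k : nat)
    (F : 'Hom(pbrauer, subvs_of (Ralg C k m))) : Prop :=
  [/\ forall s : 'S_m, vsval (F (pbasis (perm_diag s))) = Sact C k s,
      forall i : 'I_m, vsval (F (pbasis (u_diag i))) = eps C k i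
    & forall i j : 'I_m, i.+1 = j :> nat ->
        vsval (F (pbasis (p_diag i j))) = zeta C k i j].

End PartialBrauer.

(* Main.v *)
(** In the tensor basis a diagram [d] acts by a 0-1 matrix: its entry at a
    labelling of the vertices of [d] is 1 when the labelling is constant on pair
    parts and 0 on singletons.  Multiplying two such matrices counts the labellings
    of the equator: one free label for each loop, no freedom on strings, whence the
    homomorphism with parameters [k + 1] and [1].  For [m <= k] the pair parts of a
    diagram can be given distinct nonzero labels, which makes the diagram operators
    triangular, hence linearly independent.

    The operators commuting with O_k are spanned by diagrams: this is the first
    fundamental theorem for O_k, proved by induction on the number [n] of factors.
    If [w] is invariant under so_k, the identity
      (k - 1) w + sum_(b != a) (a b) w = sum_(b != a) (form)_ab . contraction_ab w
    summed over [a] shows that the Casimir element of gl_k (shifted by [- n]) maps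
    [w] into the span of the matchings.  On tensors whose weights are even, which
    the diagonal reflections ensure, this element is positive definite; projecting
    [w] orthogonally to the matchings gives the result.

    Finally the span of O_k is stable under the conjugate transpose, so it is equal
    to its double commutant: the orthogonal projection onto it, cut into blocks,
    commutes with O_k, hence with every [f] commuting with R_m. *)
From HB Require Import structures.
Require Import Defs.
From mathcomp Require Import boolp zify ring.

Set Implicit Arguments.
Unset Strict Implicit.
Unset Printing Implicit Defensive.
Import Order.TTheory GRing.Theory Num.Theory.

(** * Diagrams as involutions *)

(** A diagram is handled through the involution that exchanges the ends of each pair part and fixes
    the singletons. Its boolean labellings already determine it, so a factorisation of diagrams is
    checked on labellings, without following paths in d | d'. The graph enters through one fact: an
    outer vertex is alone in its component exactly when this component contains a singleton of d or
    of d'.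

    The passage from O_k to so_k is purely algebraic: rotations have a rational parametrisation,
    invariance becomes a polynomial identity valid at all natural parameters, and its linear
    coefficient is the infinitesimal statement.

    The fundamental theorem is proved on V alone. A tensor over C + V is cut according to the set of
    factors labelled 0; this yields diagrams whose pair labels are nonzero, and a triangular change
    of family returns to the diagram operators, whose pairs may also carry the label 0.

    Loops contribute powers of k + 1, which are invertible in characteristic 0. Hence generation of
    diagrams under plain composition gives both that R_m contains every diagram operator and that
    Psi is unique. *)

Section InvolutionParity.

Variables (T : finType) (s : T -> T).
Hypothesis sK : involutive s.

(** The points of [K] that are not fixed split into pairs {x, s x}. *)
Lemma odd_card_invol (K : {set T}) :
  (forall x, x \in K -> s x \in K) ->
  odd #|K| = odd #|[set x in K | s x == x]|.
Proof.
have [n] := ubnP #|K|; elim: n K => // n IHn K ltKn sKK.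
have [/existsP[x /andP[Kx sxx]]|/existsPn no] :=
    boolP [exists x in K, s x != x]; last first.
  congr odd; apply: eq_card => x; rewrite inE.
  by case: (boolP (x \in K)) (no x) => //= _; rewrite negbK => ->.
pose K' := K :\ x :\ s x.
have cK : #|K| = #|K'|.+2.
  by rewrite (cardsD1 x) Kx (cardsD1 (s x)) !inE sxx sKK.
have lt' : #|K'| < n by rewrite cK in ltKn; lia.
rewrite cK /= negbK (IHn K') // => [|y].
  apply: (congr1 odd); apply: eq_card => y; rewrite !inE.
  have [->|ysx] /= := eqVneq y (s x).
    by rewrite sK [x == _]eq_sym (negbTE sxx) andbF.
  by have [->|] := eqVneq y x; rewrite ?(negbTE sxx) ?andbF.
rewrite !inE => /and3P[ysx yx Ky]; rewrite sKK // andbT.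
by rewrite (inj_eq (inv_inj sK)) yx -(inj_eq (inv_inj sK)) sK ysx.
Qed.

End InvolutionParity.

Section Validity.

Variables (T : finType) (L : eqType) (z : L).

(** Fixed points of [p] stand for singletons and 2-cycles for pair parts. [L] is left general:
    boolean labels separate diagrams, labels in 0, ..., k give the matrix entries of operators. *)
Definition valid (p : T -> T) (phi : T -> L) : bool :=
  [forall v, (phi (p v) == phi v) && ((p v == v) ==> (phi v == z))].

Lemma validP p phi :
  reflect ((forall v, phi (p v) = phi v) /\ (forall v, p v = v -> phi v = z))
          (valid p phi).
Proof.
apply: (iffP forallP) => [H|[H1 H2] v].
  split=> v; first by have /andP[/eqP] := H v.
  by move=> pv; have /andP[_ /implyP] := H v; rewrite pv eqxx => /(_ isT)/eqP.
by rewrite H1 eqxx /=; apply/implyP => /eqP/H2->.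
Qed.

Lemma eq_valid p p' phi phi' : p =1 p' -> phi =1 phi' ->
  valid p phi = valid p' phi'.
Proof. by move=> ep ef; apply: eq_forallb => v; rewrite ep !ef. Qed.

End Validity.

Section Partner.

Variable m : nat.
Implicit Types (d : diagram m) (v w : vert m).

(** A singleton is its own partner. *)
Definition partner d v : vert m :=
  odflt v [pick w | (w != v) && ([set v; w] \in val d)].

Lemma diagram_cover d v : exists2 A, A \in val d & v \in A.
Proof.
case: d => P /= /andP[/and3P[/eqP cP _ _] _].
by have := in_setT v; rewrite -cP => /bigcupP[A PA Av]; exists A.
Qed.

Lemma diagram_card d A : A \in val d -> #|A| <= 2.
Proof. by case: d => P /= /andP[_ /forall_inP H] /H. Qed.

Lemma partner_uniq d v w : [set v; w] \in val d -> partner d v = w.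
Proof.
move=> dvw; rewrite /partner; case: pickP => [u /andP[uv du]|no] /=.
  have e := diagram_eq dvw du (set21 _ _) (set21 _ _).
  have : u \in [set v; w] by rewrite e set22.
  by rewrite !inE (negbTE uv) => /eqP.
by have := no w; rewrite dvw andbT => /negbFE/eqP.
Qed.

Lemma partner_block d A v : A \in val d -> v \in A -> A = [set v; partner d v].
Proof.
move=> dA Av; have szA := diagram_card dA.
have /orP[/eqP A1|/cards2P[a [b [ab AE]]]] : (#|A| == 1) || (#|A| == 2).
- have : 0 < #|A| by apply/card_gt0P; exists v.
  lia.
- have /cards1P[a AE] : #|A| == 1 by rewrite A1.
  move: Av; rewrite AE inE => /eqP va; rewrite -va.
  by rewrite (@partner_uniq d v v) setUid // va -AE.
- move: Av; rewrite AE !inE => /orP[]/eqP->.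
  + by rewrite (@partner_uniq d a b) // -AE.
  + by rewrite (@partner_uniq d b a) setUC // -AE.
Qed.

Lemma partner_in d v : [set v; partner d v] \in val d.
Proof. by have [A dA Av] := diagram_cover d v; rewrite -(partner_block dA Av). Qed.

Lemma partnerK d : involutive (partner d).
Proof. by move=> v; apply: partner_uniq; rewrite setUC partner_in. Qed.

Lemma partner_inj d d' : partner d =1 partner d' -> d = d'.
Proof.
move=> e; apply/val_inj/setP => A; apply/idP/idP => dA.
  have [A0|[v Av]] := set_0Vmem A.
    by case: (d) dA => P /= /andP[/and3P[_ _ /negP P0] _]; rewrite A0 => /P0.
  by rewrite (partner_block dA Av) e partner_in.
have [A0|[v Av]] := set_0Vmem A.
  by case: (d') dA => P /= /andP[/and3P[_ _ /negP P0] _]; rewrite A0 => /P0.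
by rewrite (partner_block dA Av) -e partner_in.
Qed.

(** The identity diagram is a junk value, returned when the sets {v, p v} do not form a diagram. *)
Definition diagram_of (p : vert m -> vert m) : diagram m :=
  insubd (perm_diag 1%g) [set [set v; p v] | v : vert m].

Lemma partner_diagram_of p : involutive p -> partner (diagram_of p) =1 p.
Proof.
move=> pK v; suff isd : is_diagram [set [set v; p v] | v : vert m].
  by apply: partner_uniq; rewrite val_insubd /= isd; apply/imsetP; exists v.
apply: (is_diagramI (f := fun v => [set v; p v])) => [w|w|A w|A].
- exact: set21.
- exact: imset_f.
- case/imsetP => u _ ->; rewrite !inE => /orP[]/eqP-> //.
  by rewrite pK setUC.
- by case/imsetP => u _ ->; apply: set2_size.
Qed.

(* A set of vertices labelled [true] is a union of pair parts. *)
Lemma eq_diagram_valid d d' :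
  (forall phi : vert m -> bool,
     valid false (partner d) phi = valid false (partner d') phi) -> d = d'.
Proof.
move=> e; apply/partner_inj => v.
have key d1 d2 : (forall phi : vert m -> bool,
    valid false (partner d1) phi -> valid false (partner d2) phi) ->
    partner d1 v != v -> partner d2 v = partner d1 v.
  move=> imp nv.
  (* The indicator of the pair part of [v] in [d1] is valid for [d1], hence for [d2]. So [d2] keeps
     [v] inside this pair, and cannot fix [v], which is labelled [true]. *)
  have /imp/validP[e1 e2]:
      valid false (partner d1) (mem [set v; partner d1 v]).
    apply/validP; split=> w /=.
      rewrite !inE orbC; congr (_ || _); first exact: (inj_eq (inv_inj (partnerK d1))).
      by rewrite -(inj_eq (inv_inj (partnerK d1))) partnerK.
    rewrite !inE => pw; apply/negbTE; rewrite negb_or; apply/andP; split.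
      by apply: contraNneq nv => <-; rewrite pw.
    by apply: contraNneq nv => wv; move: pw; rewrite wv partnerK => <-.
  have := e1 v; rewrite /= !inE eqxx /= => /orP[/eqP|/eqP//].
  by move/e2; rewrite /= !inE eqxx.
have [v1|n1] := eqVneq (partner d v) v; last by rewrite (key d d') // => ?; rewrite e.
have [v2|n2] := eqVneq (partner d' v) v; first by rewrite v1.
by rewrite (key d' d) // => ?; rewrite e.
Qed.

Lemma in_pairE d v : in_pair d v = (partner d v != v).
Proof.
apply/exists_inP/idP => [[A dA /andP[Av /eqP A2]]|nv].
  apply: contra_eq_neq A2 => pv; rewrite (partner_block dA Av) pv setUid.
  by rewrite cards1.
exists [set v; partner d v]; rewrite ?partner_in // set21 cards2.
by rewrite [v == _]eq_sym nv.
Qed.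

Lemma edgeP (h : vert m -> vert3 m) d x y : injective h ->
  reflect (exists2 v, x = h v /\ y = h (partner d v) & partner d v != v)
          (edge h d x y).
Proof.
move=> hI; apply: (iffP exists_inP) => [[A dA /andP[/eqP A2 /eqP xyA]]|].
  have : x \in h @: A by rewrite -xyA set21.
  case/imsetP => v Av xv; have AE := partner_block dA Av.
  have nv : partner d v != v by rewrite -in_pairE; apply/exists_inP; exists A;
    rewrite ?Av ?A2.
  exists v => //; split=> //.
  have : h (partner d v) \in [set x; y] by rewrite xyA imset_f // AE set22.
  by rewrite !inE xv (inj_eq hI) (negbTE nv) /= => /eqP.
case=> v [-> ->] nv; exists [set v; partner d v]; rewrite ?partner_in //.
by rewrite cards2 [v == _]eq_sym nv imsetU !imset_set1 !eqxx.
Qed.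

End Partner.

(** * Composition of diagrams *)

Section Composition.

Variable m : nat.
Variables d d' : diagram m.

Local Notation e := (partner (comp d d')).

(** These vertices force the label [z] on their whole component. *)
Definition bad (x : vert3 m) : bool :=
  [exists v, (x == top_vert v) && (partner d v == v)] ||
  [exists v, (x == bot_vert v) && (partner d' v == v)].

Lemma bad_top v : partner d v = v -> bad (top_vert v).
Proof. by move=> pv; apply/orP; left; apply/existsP; exists v; rewrite pv !eqxx. Qed.

Lemma bad_bot v : partner d' v = v -> bad (bot_vert v).
Proof. by move=> pv; apply/orP; right; apply/existsP; exists v; rewrite pv !eqxx. Qed.

Lemma badP x : bad x -> (exists2 v, x = top_vert v & partner d v = v) \/
  (exists2 v, x = bot_vert v & partner d' v = v).
Proof. by case/orP=> /existsP[v /andP[/eqP-> /eqP]]; [left|right]; exists v. Qed.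

Lemma adj_connect_sym : connect_sym (adj d d').
Proof. by apply/sym_connect_sym/adj_sym. Qed.

Lemma adj_top v : connect (adj d d') (top_vert v) (top_vert (partner d v)).
Proof.
have [->|nv] := eqVneq (partner d v) v; first exact: connect0.
by apply/connect1/orP; left; apply/(edgeP _ _ _ (@top_vert_inj m)); exists v.
Qed.

Lemma adj_bot v : connect (adj d d') (bot_vert v) (bot_vert (partner d' v)).
Proof.
have [->|nv] := eqVneq (partner d' v) v; first exact: connect0.
by apply/connect1/orP; right; apply/(edgeP _ _ _ (@bot_vert_inj m)); exists v.
Qed.

Lemma connect_out v w :
  connect (adj d d') (out_vert v) (out_vert w) = (w \in [set v; e v]).
Proof.
pose A := @out_vert m @^-1: [set y | connect (adj d d') (out_vert v) y].
have Av : v \in A by rewrite !inE connect0.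
have dA : A \in val (comp d d').
  rewrite /= in_setD1; apply/andP; split.
    by apply: contraTneq Av => ->; rewrite inE.
  by apply/imset_f/imset_f.
by rewrite -(partner_block dA Av) !inE.
Qed.

Lemma no_bot_edge v : (forall u, ~~ edge (@bot_vert m) d' (out_vert v) u) \/
  (forall u, ~~ edge (@top_vert m) d (out_vert v) u).
Proof. by case: v => i; [left|right] => u; apply/negP => /edge_ex[[] w]. Qed.

Lemma bad_end x : bad x -> (forall u, ~~ edge (@top_vert m) d x u) \/
  (forall u, ~~ edge (@bot_vert m) d' x u).
Proof.
case/badP => -[v -> pv]; [left|right] => u; apply/negP.
- by case/(edgeP _ _ _ (@top_vert_inj m)) => w [/top_vert_inj<- _]; rewrite pv eqxx.
- by case/(edgeP _ _ _ (@bot_vert_inj m)) => w [/bot_vert_inj<- _]; rewrite pv eqxx.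
Qed.

Lemma bad_out_isolated v u : bad (out_vert v) -> ~~ adj d d' (out_vert v) u.
Proof.
move=> /badP bv; rewrite negb_or; apply/andP; split; apply/negP.
- case/(edgeP _ _ _ (@top_vert_inj m)) => w [vw _].
  case: bv => -[w' vw']; rewrite vw in vw'.
    by rewrite -(top_vert_inj vw') => ->; rewrite eqxx.
  by case: v vw {vw'} (vw') => i; case: w => j //; case: w'.
- case/(edgeP _ _ _ (@bot_vert_inj m)) => w [vw _].
  case: bv => -[w' vw']; rewrite vw in vw'; last first.
    by rewrite -(bot_vert_inj vw') => ->; rewrite eqxx.
  by case: v vw {vw'} (vw') => i; case: w => j //; case: w'.
Qed.

(** A component is a path or a cycle, so it has at most two ends; a singleton and two distinct outer
    vertices would be three. If the singleton is itself an outer vertex, it is isolated in the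
    graph. *)
Lemma bad_connect x v : bad x -> connect (adj d d') x (out_vert v) -> e v = v.
Proof.
move=> bx xv; apply/eqP; apply/negPn/negP => nv.
have vw : connect (adj d d') (out_vert v) (out_vert (e v)) by rewrite connect_out set22.
have iso u u' : bad (out_vert u) -> connect (adj d d') (out_vert u) (out_vert u') ->
    u = u'.
  move=> bu /connectP[[|y s] /= pth]; first by move/out_vert_inj.
  by move: pth => /andP[]; rewrite (negbTE (bad_out_isolated y bu)).
have xNv : out_vert v != x.
  apply: contraNneq nv => vx; rewrite -vx in bx.
  by rewrite -(iso _ _ bx vw).
have xNw : out_vert (e v) != x.
  apply: contraNneq nv => wx; rewrite -wx in bx.
  by rewrite (iso _ v bx) // adj_connect_sym.
case/eqP: nv; apply: (@out_vert_inj m); apply: esym.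
apply: (@two_ends _ (edge (@top_vert m) d) (edge (@bot_vert m) d') x) => //.
- exact: edge_sym.
- exact/edge_functional/top_vert_inj.
- exact: edge_sym.
- exact/edge_functional/bot_vert_inj.
- move=> t; rewrite !inE => /or3P[]/eqP->; first exact: bad_end.
    by case: (no_bot_edge v); [right|left].
  by case: (no_bot_edge (e v)); [right|left].
- exact: connect_trans xv vw.
Qed.

Definition flip_top (x : vert3 m) : vert3 m :=
  if x is inl v then top_vert (partner d v) else x.

Definition flip_bot (x : vert3 m) : vert3 m :=
  match x with
  | inl (inl i) => x
  | inl (inr i) => bot_vert (partner d' (inl i))
  | inr i => bot_vert (partner d' (inr i))
  end.

Lemma flip_botE v : flip_bot (bot_vert v) = bot_vert (partner d' v).
Proof. by case: v. Qed.

Lemma flip_topK : involutive flip_top.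
Proof. by case=> // v; rewrite /= /top_vert partnerK. Qed.

Lemma flip_botK : involutive flip_bot.
Proof. by case=> [[i|i]|i] //; rewrite [flip_bot _]/= flip_botE partnerK. Qed.

(* In a component without singletons, the vertices of the upper row and those
   of the lower row are the fixed points of two involutions, hence their
   numbers have the same parity. *)
Lemma fixed_connect v : e v = v ->
  exists2 x, bad x & connect (adj d d') (out_vert v) x.
Proof.
move=> ev; pose K := [set y | connect (adj d d') (out_vert v) y].
suff /existsP[x /andP[bx xv]] : [exists x, bad x && (x \in K)].
  by exists x => //; rewrite inE in xv.
apply: contraT => /existsPn noK.
have good x : x \in K -> ~~ bad x by move=> xK; have := noK x; rewrite xK andbT.
have outK w : out_vert w \in K -> w = v.
  by rewrite inE connect_out ev setUid inE => /eqP.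
have vK : out_vert v \in K by rewrite inE connect0.
have K1 : odd #|K| = odd #|[set x in K | flip_top x == x]|.
  apply: (odd_card_invol flip_topK) => x.
  rewrite !inE => vx; apply: connect_trans vx _.
  by case: x => [w|i]; [apply: adj_top|apply: connect0].
have K2 : odd #|K| = odd #|[set x in K | flip_bot x == x]|.
  apply: (odd_card_invol flip_botK) => x.
  rewrite !inE => vx; apply: connect_trans vx _.
  by case: x => [[i|i]|i]; [apply: connect0|apply: (adj_bot (inl i))|apply:
    (adj_bot (inr i))].
have f1 x : x \in K -> flip_top x == x -> exists i, x = inr i.
  case: x => [w|i] xK /=; last by exists i.
  by move=> /eqP/top_vert_inj/bad_top bx; have := good _ xK; rewrite bx.
have f2 x : x \in K -> flip_bot x == x -> exists i, x = inl (inl i).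
  case: x => [[i|i]|i] xK; first by exists i.
  - move=> /eqP/(@bot_vert_inj m (partner d' (inl i)) (inl i))/bad_bot bx.
    by have := good _ xK; rewrite bx.
  - move=> /eqP/(@bot_vert_inj m (partner d' (inr i)) (inr i))/bad_bot bx.
    by have := good _ xK; rewrite bx.
(* As [v] is the only outer vertex of [K], one flip has no fixed point in [K] and the other has
   exactly one: #|K| would be both even and odd. *)
case: v ev @K noK good outK vK K1 K2 f1 f2 => i ev K noK good outK vK K1 K2 f1 f2.
- suff : odd #|K| by rewrite K1 (_ : [set x in K | _] = set0) ?cards0 //;
    apply/setP => x; rewrite in_set in_set0; apply/negbTE/andP => -[xK /(f1 x xK)[j xj]];
    move: xK; rewrite xj => /(outK (inr j)).
  rewrite K2 (_ : [set x in K | _] = [set out_vert (inl i)]) ?cards1 //.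
  apply/setP => x; rewrite in_set in_set1; apply/andP/eqP => [[xK /(f2 x xK)[j xj]]|->].
    by move: xK; rewrite xj => /(outK (inl j))->.
  by [].
- suff : odd #|K| by rewrite K2 (_ : [set x in K | _] = set0) ?cards0 //;
    apply/setP => x; rewrite in_set in_set0; apply/negbTE/andP => -[xK /(f2 x xK)[j xj]];
    move: xK; rewrite xj => /(outK (inl j)).
  rewrite K1 (_ : [set x in K | _] = [set out_vert (inr i)]) ?cards1 //.
  apply/setP => x; rewrite in_set in_set1; apply/andP/eqP => [[xK /(f1 x xK)[j xj]]|->].
    by move: xK; rewrite xj => /(outK (inr j))[->].
  by [].
Qed.

End Composition.

Definition glue (m : nat) (L : Type) (I J : 'I_m -> L) (v : vert m) : L :=
  match v with inl i => I i | inr i => J i end.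

Section Labellings.

Variables (m : nat) (L : finType) (z : L) (d d' : diagram m).

Local Notation e := (partner (comp d d')).

Definition label3 (I K J : 'I_m -> L) (x : vert3 m) : L :=
  match x with inl (inl i) => I i | inl (inr i) => K i | inr i => J i end.

(** Pair parts are the edges of the graph, so constancy on pair parts spreads to components.
    Counting labellings thus becomes counting components. *)
Lemma valid_label3 (I K J : 'I_m -> L) :
  valid z (partner d) (glue I K) && valid z (partner d') (glue K J) <->
  (forall x y, connect (adj d d') x y -> label3 I K J x = label3 I K J y) /\
  (forall x, bad d d' x -> label3 I K J x = z).
Proof.
have tE v : label3 I K J (top_vert v) = glue I K v by case: v.
have bE v : label3 I K J (bot_vert v) = glue K J v by case: v.
split=> [/andP[/validP[t1 t2] /validP[b1 b2]]|[H1 H2]]; last first.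
  apply/andP; split; apply/validP; split=> v.
  - by rewrite -!tE; apply/esym/H1/adj_top.
  - by rewrite -tE => /bad_top bv; apply/H2/bv.
  - by rewrite -!bE; apply/esym/H1/adj_bot.
  - by rewrite -bE => /bad_bot bv; apply/H2/bv.
split=> [x y /connectP[s]|x /badP[] [v ->]].
- elim: s x => [|u s IHs] x /= => [_ ->//|/andP[xu pth yE]].
  rewrite -(IHs u pth yE); case/orP: xu.
  + by case/(edgeP _ _ _ (@top_vert_inj m)) => v [-> ->] _; rewrite !tE.
  + by case/(edgeP _ _ _ (@bot_vert_inj m)) => v [-> ->] _; rewrite !bE.
- by rewrite tE => /t2.
- by rewrite bE => /b2.
Qed.

Definition loops : {set {set vert3 m}} :=
  [set K in components d d' | (K \subset equator m) && is_loop d d' K].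

Local Notation cl x := [set y | connect (adj d d') x y].

Lemma cl_loops_out x v : connect (adj d d') x (out_vert v) -> cl x \notin loops.
Proof.
move=> xv; rewrite inE negb_and; apply/orP; right; rewrite negb_and.
apply/orP; left; apply/subsetPn; exists (out_vert v); first by rewrite inE.
by apply/imsetP => -[i _]; case: v {xv}.
Qed.

Lemma cl_loops_bad x y : connect (adj d d') x y -> bad d d' y -> cl x \notin loops.
Proof.
move=> xy /badP[] [[i|i] yE pv]; first 1 last.
- rewrite inE !negb_and; apply/orP; right; apply/orP; right.
  apply/forallPn; exists i;
    rewrite negb_imply inE -[inl (inr i)]/(top_vert (inr i)) -yE xy.
  by rewrite negb_and !in_pairE pv eqxx.
- rewrite inE !negb_and; apply/orP; right; apply/orP; right.
  apply/forallPn; exists i;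
    rewrite negb_imply inE -[inl (inr i)]/(bot_vert (inl i)) -yE xy.
  by rewrite negb_and !in_pairE pv eqxx orbT.
- by apply: (@cl_loops_out _ (inr i)); rewrite yE in xy.
- by apply: (@cl_loops_out _ (inl i)); rewrite yE in xy.
Qed.

(** Together with the two lemmas above, this identifies the loops as the components with neither an
    outer vertex nor a singleton: those whose label stays free. *)
Lemma cl_loops x : (forall v, ~~ connect (adj d d') x (out_vert v)) ->
  (forall y, connect (adj d d') x y -> ~~ bad d d' y) -> cl x \in loops.
Proof.
move=> nout nbad; rewrite inE imset_f //=; apply/andP; split.
  apply/subsetP => -[[i|i]|i]; rewrite inE => xi.
  - by have := nout (inl i); rewrite xi.
  - exact: imset_f.
  - by have := nout (inr i); rewrite xi.
apply/forallP => i; apply/implyP; rewrite inE => /nbad; rewrite !in_pairE => nb.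
by apply/andP; split; apply: contraNneq nb => pv;
  [apply: (@bad_top _ d d' (inr i))|apply: (@bad_bot _ d d' (inl i))].
Qed.

Section Extension.

Variables (I J : 'I_m -> L) (g : {ffun {set vert3 m} -> L}).

(** The label is chosen by [g] on loops, imposed by [I] and [J] on components that reach the outer
    rows, and equal to [z] on open strings. Which outer vertex is picked does not matter once [I]
    and [J] are valid for the composite. *)
Definition ext_label (x : vert3 m) : L :=
  if cl x \in loops then g (cl x)
  else if [pick v | connect (adj d d') x (out_vert v)] is Some v
  then glue I J v else z.

Definition ext_eq : {ffun 'I_m -> L} := [ffun i => ext_label (inl (inr i))].

Lemma eq_ext_label x y : connect (adj d d') x y -> ext_label x = ext_label y.
Proof.
move=> xy; have cs := same_connect (@adj_connect_sym _ d d') xy.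
rewrite /ext_label (_ : cl x = cl y); last by apply/setP => t; rewrite !inE cs.
by under eq_pick do rewrite cs.
Qed.

Hypothesis vIJ : valid z e (glue I J).

Lemma ext_label_out v : ext_label (out_vert v) = glue I J v.
Proof.
have [e1 e2] := validP _ _ _ vIJ.
rewrite /ext_label (negbTE (@cl_loops_out _ v _)) ?connect0 //.
case: pickP => [w|/(_ v)]; last by rewrite connect0.
by rewrite connect_out !inE => /orP[]/eqP->; rewrite ?e1.
Qed.

Lemma ext_eqE : label3 I ext_eq J =1 ext_label.
Proof.
case=> [[i|i]|i] /=; last exact: esym (ext_label_out (inr i)).
  exact: esym (ext_label_out (inl i)).
by rewrite ffunE.
Qed.

Lemma valid_ext :
  valid z (partner d) (glue I ext_eq) && valid z (partner d') (glue ext_eq J).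
Proof.
have [e1 e2] := validP _ _ _ vIJ.
apply/valid_label3; split=> [x y xy|x bx]; rewrite !ext_eqE; first exact: eq_ext_label.
rewrite /ext_label (negbTE (@cl_loops_bad _ x _ _)) ?connect0 //.
by case: pickP => // v xv; apply: e2; apply: (bad_connect bx).
Qed.

End Extension.

Lemma valid_comp (I K J : 'I_m -> L) :
  valid z (partner d) (glue I K) -> valid z (partner d') (glue K J) ->
  valid z e (glue I J).
Proof.
move=> v1 v2; have [H1 H2] := (valid_label3 I K J).1 (introT andP (conj v1 v2)).
have oE v : glue I J v = label3 I K J (out_vert v) by case: v.
apply/validP; split=> v; rewrite !oE.
  by apply/esym/H1; rewrite connect_out set22.
by case/fixed_connect => x bx vx; rewrite (H1 _ _ vx) H2.
Qed.

Lemma card_valid (I J : 'I_m -> L) :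
  #|[set K : {ffun 'I_m -> L} |
     valid z (partner d) (glue I K) && valid z (partner d') (glue K J)]| =
  #|L| ^ nb_loops d d' * valid z e (glue I J).
Proof.
have [vIJ|nv] := boolP (valid z e (glue I J)); last first.
  rewrite muln0; apply: eq_card0 => K; rewrite inE; apply: contraNF nv.
  by case/andP; apply: valid_comp.
(* A choice of labels for the loops is encoded as a function on all sets of vertices that is [z]
   outside [loops]; [ext_eq] maps these choices bijectively to the admissible [K]. *)
rewrite muln1 -[nb_loops d d']/(#|loops|) -(card_pffun_on z (mem loops) (predT :
  {pred L})).
rewrite -(card_in_imset (f := ext_eq I J)) => [|g g' /pffun_onP[sg _] /pffun_onP[sg' _] gg'].
  apply: eq_card => K; rewrite inE; apply/idP/imsetP => [vK|[g _ ->]]; last exact: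
    valid_ext.
  have [H1 H2] := (valid_label3 I K J).1 vK.
  pose g : {ffun {set vert3 m} -> L} := [ffun C => if C \in loops then
    (if [pick x in C] is Some x then label3 I K J x else z) else z].
  exists g.
    apply/pffun_onP; split=> //; apply/subsetP => C; rewrite inE ffunE.
    by case: ifP; rewrite // eqxx.
  apply/ffunP => i; rewrite ffunE /ext_label.
  rewrite -[K i]/(label3 I K J (inl (inr i))).
  have [lp|nlp] := ifPn.
    rewrite ffunE lp; case: pickP => [x|/(_ (inl (inr i)))]; last by rewrite inE connect0.
    by rewrite inE => /H1.
  case: pickP => [v /H1->|no]; first by case: v.
  (* This component is neither a loop nor joined to an outer vertex, so it contains a singleton,
     which forces [K i] to be [z]. *)
  have /existsP[y /andP[iy by_]] :
    [exists y, connect (adj d d') (inl (inr i)) y && bad d d' y].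
    apply: contraNT nlp => /existsPn nb; apply: cl_loops => [v|y iy]; first by rewrite no.
    by have := nb y; rewrite iy.
  by rewrite (H1 _ _ iy) H2.
apply/ffunP => C; have [lC|nC] := boolP (C \in loops); last first.
  have z0 h : z.-support h \subset mem loops -> h C = z.
    move=> /subsetP/(_ C) sC; apply/eqP; apply: contraNT nC => nz; exact: sC.
  by rewrite !z0.
have [x xC CE] : exists2 i, inl (inr i) \in C & C = cl (inl (inr i)).
  move: (lC); rewrite inE => /and3P[/imsetP[x _ CE] /subsetP sub _].
  have xC : x \in C by rewrite CE inE connect0.
  by have /imsetP[i _ xi] := sub x xC; exists i; rewrite -xi.
by move/ffunP/(_ x): gg'; rewrite !ffunE /ext_label -CE lC.
Qed.

End Labellings.

Lemma comp_validP m (L : finType) (z : L) (d d' : diagram m) (I J : 'I_m -> L) :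
  reflect (exists K, valid z (partner d) (glue I K) && valid z (partner d') (glue K J))
    (valid z (partner (comp d d')) (glue I J)).
Proof.
apply: (iffP idP) => [v|[K /andP[]]]; last exact: valid_comp.
by exists (ext_eq z d d' I J [ffun=> z]); apply: valid_ext.
Qed.

(** * Generation of diagrams *)

Section Generators.

Variable m : nat.
Implicit Types (a b i j l : 'I_m) (d : diagram m).

Lemma partner_perm (s : 'S_m) (v : vert m) : partner (perm_diag s) v =
  match v with inl i => inr ((s^-1)%g i) | inr i => inl (s i) end.
Proof.
apply: partner_uniq; apply/imsetP; case: v => i.
  by exists ((s^-1)%g i); rewrite ?permKV.
by exists i; rewrite // setUC.
Qed.

Lemma partner_u a (v : vert m) : partner (u_diag a) v =
  match v with inl i => if i == a then inl i else inr i
             | inr i => if i == a then inr i else inl i end.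
Proof.
apply: partner_uniq; rewrite in_setU in_set2.
have side i : i != a -> [set inl i; inr i] \in [set [set inl l; inr l] | l : 'I_m &
  l != a].
  by move=> ia; apply/imsetP; exists i; rewrite ?inE.
case: v => i; have [->|/side sI] := eqVneq i a; rewrite ?setUid ?eqxx ?orbT //.
  by rewrite sI orbT.
by rewrite setUC sI orbT.
Qed.

Lemma partner_p a b (v : vert m) : a != b -> partner (p_diag a b) v =
  match v with
  | inl i => if i == a then inl b else if i == b then inl a else inr i
  | inr i => if i == a then inr b else if i == b then inr a else inl i
  end.
Proof.
move=> ab; apply: partner_uniq; rewrite in_setU in_set2.
have side i : i != a -> i != b -> [set inl i; inr i] \in
    [set [set inl l; inr l] | l : 'I_m & (l != a) && (l != b)].
  by move=> ia ib; apply/imsetP; exists i; rewrite ?inE ?ia.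
case: v => i; have [->|ia] := eqVneq i a; rewrite ?eqxx ?orbT //.
- have [->|ib] := eqVneq i b; first by rewrite setUC eqxx.
  by rewrite side ?orbT.
- have [->|ib] := eqVneq i b; first by rewrite [[set inr b; _]]setUC eqxx orbT.
  by rewrite setUC side ?orbT.
Qed.

Section Valid.

Variables (L : eqType) (z : L).
Implicit Types I J : 'I_m -> L.

Lemma valid_permP (s : 'S_m) I J :
  reflect (forall i, I (s i) = J i) (valid z (partner (perm_diag s)) (glue I J)).
Proof.
apply: (iffP (validP _ _ _)) => [[H _] i|H]; first
  by rewrite -[RHS](H (inr i)) partner_perm.
split=> -[i|i]; rewrite partner_perm //=; by rewrite -?H ?permKV.
Qed.

Lemma valid_uP a I J :
  reflect [/\ I a = z, J a = z & forall i, i != a -> I i = J i]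
    (valid z (partner (u_diag a)) (glue I J)).
Proof.
apply: (iffP (validP _ _ _)) => [[H1 H2]|[Ia Ja H]].
  split; [apply: (H2 (inl a))|apply: (H2 (inr a))|]; rewrite ?partner_u ?eqxx //.
  by move=> i ia; have := H1 (inr i); rewrite partner_u (negbTE ia).
by split=> -[i|i]; rewrite partner_u /=; have [->|ia] := eqVneq i a => //=; rewrite ?H.
Qed.

Lemma valid_pP a b I J : a != b ->
  reflect [/\ I a = I b, J a = J b & forall i, i != a -> i != b -> I i = J i]
    (valid z (partner (p_diag a b)) (glue I J)).
Proof.
move=> ab; apply: (iffP (validP _ _ _)) => [[H1 H2]|[Iab Jab H]].
  split.
  - by have := H1 (inl a); rewrite partner_p // eqxx.
  - by have := H1 (inr a); rewrite partner_p // eqxx.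
  - by move=> i ia ib; have := H1 (inr i); rewrite partner_p // (negbTE ia) (negbTE ib).
have ba c : (if c then b else a) = (if c then a else b) -> False.
  by case: c => /eqP; rewrite ?(negbTE ab) // eq_sym (negbTE ab).
split=> -[i|i]; rewrite partner_p //=; have [ia|ia] := eqVneq i a => //=;
  rewrite ?ia //; try by case=> /(ba true).
all: have [ib|ib] := eqVneq i b; rewrite ?ib //; try by case=> /(ba false).
all: by rewrite /= ?H.
Qed.

End Valid.

(** Two labels suffice to recognise a composite; the factorisations below reduce to exhibiting the
    labelling [K] of the equator. *)
Lemma eq_comp_valid d0 d d' :
  (forall I J : 'I_m -> bool, valid false (partner d0) (glue I J) <->
     exists K, valid false (partner d) (glue I K) && valid false (partner d') (glue K J)) ->
  d0 = comp d d'.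
Proof.
move=> H; apply: eq_diagram_valid => phi.
pose I i := phi (inl i); pose J i := phi (inr i).
have E : phi =1 glue I J by case.
rewrite (eq_valid _ (frefl _) E) (eq_valid _ (frefl (partner (comp d d'))) E).
by apply/idP/comp_validP => [/H//|]; move/H.
Qed.

Definition split_pair (p : vert m -> vert m) (a b v : vert m) :=
  if (v == a) || (v == b) then v else p v.

Definition join_pair (p : vert m -> vert m) (a b v : vert m) :=
  if v == a then b else if v == b then a else p v.

Lemma split_pairK (p : vert m -> vert m) (a b : vert m) : involutive p -> p a = b ->
  involutive (split_pair p a b).
Proof.
move=> pK pa v; have pb : p b = a by rewrite -pa pK.
rewrite /split_pair; have [->|va] := eqVneq v a; first by rewrite eqxx.
have [->|vb] /= := eqVneq v b; first by rewrite eqxx orbT.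
by rewrite -{1}pb -{2}pa !(inj_eq (inv_inj pK)) (negbTE va) (negbTE vb) pK.
Qed.

Lemma join_pairK (p : vert m -> vert m) (a b : vert m) : involutive p -> p a = a ->
  p b = b -> involutive (join_pair p a b).
Proof.
move=> pK pa pb v.
rewrite /join_pair; have [->|va] := eqVneq v a.
  by rewrite eqxx; case: eqP.
have [->|vb] := eqVneq v b; first by rewrite eqxx.
by rewrite -{1}pa -{2}pb !(inj_eq (inv_inj pK)) (negbTE va) (negbTE vb) pK.
Qed.

Lemma valid_splitP (L : eqType) (z : L) (p : vert m -> vert m) (a b : vert m) phi :
  involutive p -> p a = b -> reflect [/\ phi a = z, phi b = z &
   forall v, v != a -> v != b -> phi (p v) = phi v /\ (p v = v -> phi v = z)]
    (valid z (split_pair p a b) phi).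
Proof.
move=> pK pa; apply: (iffP (validP _ _ _)) => [[H1 H2]|[Ha Hb H]].
  split; [by apply: H2; rewrite /split_pair eqxx|
          by apply: H2; rewrite /split_pair eqxx orbT|].
  move=> v va vb; have := H1 v; have := H2 v.
  by rewrite /split_pair (negbTE va) (negbTE vb).
split=> v; rewrite /split_pair; have [->|va] //= := eqVneq v a;
  have [->|vb] //= := eqVneq v b; by have [] := H v va vb.
Qed.

Lemma valid_joinP (L : eqType) (z : L) (p : vert m -> vert m) (a b : vert m) phi :
  involutive p -> p a = a -> p b = b -> a != b -> reflect (phi a = phi b /\
   forall v, v != a -> v != b -> phi (p v) = phi v /\ (p v = v -> phi v = z))
    (valid z (join_pair p a b) phi).
Proof.
move=> pK pa pb ab; apply: (iffP (validP _ _ _)) => [[H1 H2]|[Hab H]].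
  split; first by have := H1 a; rewrite /join_pair eqxx.
  move=> v va vb; have := H1 v; have := H2 v.
  by rewrite /join_pair (negbTE va) (negbTE vb).
split=> v; rewrite /join_pair; have [->|va] := eqVneq v a => //.
- by have [->|vb] := eqVneq v b => //; have [] := H v va vb.
- by move=> ba; rewrite ba eqxx in ab.
- have [->|vb] := eqVneq v b; first by move=> ba; rewrite ba eqxx in ab.
  by have [] := H v va vb.
Qed.

(** The lower arc of [p_diag a b] meets the two new singletons in an open string inside the equator,
    which disappears; the upper arc restores the pair. *)
Lemma split_top d a b : a != b -> partner d (inl a) = inl b ->
  d = comp (p_diag a b) (diagram_of (split_pair (partner d) (inl a) (inl b))).
Proof.
move=> ab pa; have pK := @partnerK _ d; set p := partner d in pa pK *.
have pb : p (inl b) = inl a by rewrite -pa pK.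
apply: eq_comp_valid => I J; rewrite -?/p.
have spE := partner_diagram_of (split_pairK pK pa).
have off K v : (forall i, i != a -> i != b -> I i = K i) -> v != inl a -> v != inl b ->
    glue K J v = glue I J v by move=> IK; case: v => //= i ia ib; rewrite IK.
have pN v : v != inl a -> v != inl b -> p v != inl a /\ p v != inl b.
  by move=> va vb; rewrite -{1}pb -{2}pa !(inj_eq (inv_inj pK)).
split=> [/validP[H1 H2]|[K /andP[/valid_pP-/(_ ab)[Iab Kab IK]]]].
  (* At [a] and [b] the equator meets singletons of the split diagram, hence [false]; elsewhere the
     vertical strands of [p_diag] copy [I]. *)
  exists (fun i => if (i == a) || (i == b) then false else I i).
  have IK i : i != a -> i != b -> I i = if (i == a) || (i == b) then false else I i.
    by move=> /negbTE-> /negbTE->.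
  apply/andP; split.
    apply/valid_pP => //; split=> //; last by rewrite !eqxx orbT.
    by have := H1 (inl b); rewrite pb.
  rewrite (eq_valid _ spE (frefl _)); apply/valid_splitP => //; split=> //=;
    rewrite ?eqxx ?orbT //.
  move=> v va vb; have [pva pvb] := pN v va vb.
  by rewrite !(off _ _ IK) //; split; [apply: H1|apply: H2].
rewrite (eq_valid _ spE (frefl _)) => /valid_splitP-/(_ pK pa)[Ka Kb H].
apply/validP; split=> v.
  have [->|va] := eqVneq v (inl a); first by rewrite pa /= Iab.
  have [->|vb] := eqVneq v (inl b); first by rewrite pb /= Iab.
  have [pva pvb] := pN v va vb.
  by rewrite -!(off K) //; have [] := H v va vb.
have [->|va] := eqVneq v (inl a); first by rewrite pa => -[ba]; rewrite ba eqxx in ab.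
have [->|vb] := eqVneq v (inl b); first by rewrite pb => -[ba]; rewrite ba eqxx in ab.
by rewrite -(off K) //; have [_] := H v va vb.
Qed.

Lemma split_bot d a b : a != b -> partner d (inr a) = inr b ->
  d = comp (diagram_of (split_pair (partner d) (inr a) (inr b))) (p_diag a b).
Proof.
move=> ab pa; have pK := @partnerK _ d; set p := partner d in pa pK *.
have pb : p (inr b) = inr a by rewrite -pa pK.
apply: eq_comp_valid => I J; rewrite -?/p.
have spE := partner_diagram_of (split_pairK pK pa).
have off K v : (forall i, i != a -> i != b -> K i = J i) -> v != inr a -> v != inr b ->
    glue I K v = glue I J v by move=> IK; case: v => //= i ia ib; rewrite IK.
have pN v : v != inr a -> v != inr b -> p v != inr a /\ p v != inr b.
  by move=> va vb; rewrite -{1}pb -{2}pa !(inj_eq (inv_inj pK)).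
split=> [/validP[H1 H2]|[K /andP[vK /valid_pP-/(_ ab)[Kab Jab KJ]]]].
  exists (fun i => if (i == a) || (i == b) then false else J i).
  have KJ i : i != a -> i != b -> (if (i == a) || (i == b) then false else J i) = J i.
    by move=> /negbTE-> /negbTE->.
  apply/andP; split; last first.
    apply/valid_pP => //; split=> //; first by rewrite !eqxx orbT.
    by have := H1 (inr b); rewrite pb.
  rewrite (eq_valid _ spE (frefl _)); apply/valid_splitP => //; split=> //=;
    rewrite ?eqxx ?orbT //.
  move=> v va vb; have [pva pvb] := pN v va vb.
  by rewrite !(off _ _ KJ) //; split; [apply: H1|apply: H2].
move: vK; rewrite (eq_valid _ spE (frefl _)) => /valid_splitP-/(_ pK pa)[Ka Kb H].
apply/validP; split=> v.
  have [->|va] := eqVneq v (inr a); first by rewrite pa /= Jab.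
  have [->|vb] := eqVneq v (inr b); first by rewrite pb /= Jab.
  have [pva pvb] := pN v va vb.
  by rewrite -!(off K) //; have [] := H v va vb.
have [->|va] := eqVneq v (inr a); first by rewrite pa => -[ba]; rewrite ba eqxx in ab.
have [->|vb] := eqVneq v (inr b); first by rewrite pb => -[ba]; rewrite ba eqxx in ab.
by rewrite -(off K) //; have [_] := H v va vb.
Qed.

(** The lower singleton of [u_diag a] cuts the strand that joins [a] to [b], leaving a singleton at
    each of its ends. *)
Lemma join_singles d a b : partner d (inl a) = inl a -> partner d (inr b) = inr b ->
  d = comp (u_diag a) (diagram_of (join_pair (partner d) (inl a) (inr b))).
Proof.
move=> pa pb; have pK := @partnerK _ d; set p := partner d in pa pb pK *.
apply: eq_comp_valid => I J; rewrite -?/p.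
have spE := partner_diagram_of (join_pairK pK pa pb).
have off K v : (forall i, i != a -> I i = K i) -> v != inl a ->
    glue K J v = glue I J v by move=> IK; case: v => //= i ia; rewrite IK.
have pN v : v != inl a -> p v != inl a by move=> va; rewrite -pa (inj_eq (inv_inj pK)).
split=> [/validP[H1 H2]|[K /andP[/valid_uP[Ia Ka IK]]]].
  exists (fun i => if i == a then false else I i).
  have IK i : i != a -> I i = if i == a then false else I i by move=> /negbTE->.
  apply/andP; split.
    by apply/valid_uP; split=> //; [apply: (H2 (inl a))|rewrite eqxx].
  rewrite (eq_valid _ spE (frefl _)); apply/valid_joinP => //; split=> /=.
    by rewrite eqxx; apply/esym/(H2 (inr b)).
  move=> v va vb; rewrite !(off _ _ IK) //; last exact: pN.
  by split; [apply: H1|apply: H2].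
rewrite (eq_valid _ spE (frefl _)) => /valid_joinP-/(_ pK pa pb isT)[Kab H].
have Jb : J b = false by rewrite -[J b]/(glue K J (inr b)) -Kab.
apply/validP; split=> v.
  have [->|va] := eqVneq v (inl a); first by rewrite pa.
  have [->|vb] := eqVneq v (inr b); first by rewrite pb.
  by rewrite -!(off K) //; [have [] := H v va vb|apply: pN].
have [->|va] := eqVneq v (inl a); first by [].
have [->|vb] := eqVneq v (inr b); first by [].
by rewrite -(off K) //; have [_] := H v va vb.
Qed.

(** Brings the diagrams [p_diag] of arbitrary positions back to adjacent ones. *)
Lemma conj_p (s : 'S_m) a b : a != b ->
  p_diag (s a) (s b) = comp (comp (perm_diag s) (p_diag a b)) (perm_diag (s^-1)%g).
Proof.
move=> ab; have sab : s a != s b by rewrite (inj_eq perm_inj).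
apply: eq_comp_valid => I J; split.
  move=> /valid_pP-/(_ sab)[Iab Jab H]; exists (fun i => J (s i)).
  apply/andP; split; last by apply/valid_permP => i; rewrite permKV.
  apply/(@comp_validP _ bool); exists (fun i => I (s i)); apply/andP; split.
    exact/valid_permP.
  by apply/valid_pP => //; split=> // i ia ib; apply: H; rewrite (inj_eq perm_inj).
case=> K /andP[/(@comp_validP _ bool)[K' /andP[/valid_permP H1 /valid_pP-/(_ ab)[e1 e2 e3]]]].
move=> /valid_permP H2.
apply/valid_pP => //; split; rewrite -?H2 ?permK ?H1 //.
move=> i; rewrite -{1 2}(permKV s i) !(inj_eq perm_inj) => ia ib.
by rewrite -H2 -e3 // -H1 permKV.
Qed.

End Generators.

(** Generation is stated for [comp], without loop factors; each application divides by the power of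
    k + 1 on its own. *)
Lemma diagram_ind m (G : diagram m -> Prop) :
  (forall s, G (perm_diag s)) -> (forall i, G (u_diag i)) ->
  (forall i j : 'I_m, i.+1 = j :> nat -> G (p_diag i j)) ->
  (forall d d', G d -> G d' -> G (comp d d')) -> forall d, G d.
Proof.
move=> Gs Gu Gp Gc.
have Gpp a b : a != b -> G (p_diag a b).
  move=> ab; have m2 : 1 < m.
    by move: ab; rewrite -val_eqE /=; have := ltn_ord a; have := ltn_ord b; lia.
  pose i0 : 'I_m := Ordinal (ltnW m2); pose i1 : 'I_m := Ordinal m2.
  have [s [<- <-]] : exists s : 'S_m, s i0 = a /\ s i1 = b.
    pose t := tperm i0 a; have tb : t b != i0.
      by rewrite -(tpermR i0 a) (inj_eq perm_inj) eq_sym.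
    exists (tperm i1 (t b) * t)%g; rewrite !permM tpermL tpermK; split=> //.
    have -> : tperm i1 (t b) i0 = i0 by rewrite tpermD.
    by rewrite tpermL.
  by rewrite conj_p //; apply/Gc => //; apply: Gc => //; apply: Gp.
pose horiz (v w : vert m) :=
  match v, w with inl _, inl _ | inr _, inr _ => true | _, _ => false end.
(* Partial permutations, by induction on the number of singletons: an upper and a lower one are
   joined, at the price of a factor [u_diag]. *)
have vertical d : (forall v, partner d v != v -> ~~ horiz v (partner d v)) -> G d.
  have [n] := ubnP #|[set v | partner d v == v]|; elim: n d => // n IHn d ltn nh.
  have pK := @partnerK _ d.
  have [/existsP[a /eqP pa]|/existsPn na] := boolP [exists a, partner d (inl a) == inl a].
    have [/existsP[b /eqP pb]|/existsPn nb] :=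
      boolP [exists b, partner d (inr b) == inr b].
      rewrite (join_singles pa pb); apply: (Gc) => //.
      have jE := partner_diagram_of (join_pairK pK pa pb).
      apply: IHn => [|v]; last first.
        rewrite !jE /join_pair; have [->//|_] := eqVneq v (inl a).
        by have [->//|_] := eqVneq v (inr b); apply: nh.
      apply: leq_trans (proper_card _) (ltn : _ <= n); apply/properP; split.
        apply/subsetP => v; rewrite !inE jE /join_pair.
        have [->|_] := eqVneq v (inl a); first by rewrite pa.
        by have [->|_] := eqVneq v (inr b); first by rewrite pb.
      by exists (inl a); rewrite inE ?pa // jE /join_pair eqxx.
    (* Without lower singletons the lower row is matched injectively, hence onto, with the upper
       row, and [a] could not be a singleton. *)
    pose f b := if partner d (inr b) is inl i then i else a.
    have fE b : partner d (inr b) = inl (f b).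
      by have := nh _ (nb b); rewrite /f; case: (partner d (inr b)).
    have fI : injective f.
      move=> b c fbc; have : partner d (inr b) = partner d (inr c) by rewrite !fE fbc.
      by case/(inv_inj pK).
    have [b ba] : exists b, f b = a.
      have /codomP[b ab] : a \in codom f by apply: inj_card_onto => //.
      by exists b.
    by have := pK (inr b); rewrite fE ba pa.
  pose f a := if partner d (inl a) is inr i then i else a.
  have fE b : partner d (inl b) = inr (f b).
    by have := nh _ (na b); rewrite /f; case: (partner d (inl b)).
  have fI : injective f.
    move=> b c fbc; have : partner d (inl b) = partner d (inl c) by rewrite !fE fbc.
      by case/(inv_inj pK).
  (* [f] runs from the upper row to the lower one, whereas [perm_diag s] joins [s i] above to [i]
     below: hence the inverse. *)
  suff -> : d = perm_diag (perm fI)^-1%g by [].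
  apply: partner_inj => -[i|i]; rewrite partner_perm ?invgK; first by rewrite permE fE.
  have fx : f ((perm fI)^-1%g i) = i by rewrite -[f _](permE fI) permKV.
  by rewrite -{1}fx -fE pK.
move=> d.
have [n] := ubnP #|[set v | (partner d v != v) && horiz v (partner d v)]|; elim:
  n d => // n IHn d ltn.
have pK := @partnerK _ d.
(* Splitting a horizontal pair decreases the measure; the singletons it creates are allowed in
   [vertical]. *)
have dec v w : partner d v = w -> v != w -> horiz v w ->
  G (diagram_of (split_pair (partner d) v w)).
  move=> pv vw hv; apply: IHn; have sE := partner_diagram_of (split_pairK pK pv).
  apply: leq_trans (proper_card _) (ltn : _ <= n); apply/properP; split.
    apply/subsetP => u; rewrite !inE sE /split_pair.
    by case: ifP; rewrite ?eqxx.
  by exists v; rewrite inE ?pv ?sE /split_pair ?eqxx // hv eq_sym vw.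
have [/existsP[v /andP[nv hv]]|/existsPn nh] :=
  boolP [exists v, (partner d v != v) && horiz v (partner d v)].
  case: v nv hv => a; case E: (partner d _) => [b|b] //= ba _.
  - have ab : a != b by apply: contraNneq ba => ->.
    by rewrite (split_top ab E); apply: (Gc); [apply: Gpp|apply: dec => //;
      rewrite eq_sym].
  - have ab : a != b by apply: contraNneq ba => ->.
    by rewrite (split_bot ab E); apply: (Gc); [apply: dec => //; rewrite eq_sym|apply:
      Gpp].
by apply: vertical => v nv; have := nh v; rewrite nv.
Qed.

(** * Diagram operators *)

Local Open Scope ring_scope.

Section Operators.

Variables (C : fieldType) (k m : nat).
Implicit Types (I J K : midx k m) (f g : tend C k m) (d : diagram m).

Lemma tend_ext f g : (forall I J, f (tbasis C J) I = g (tbasis C J) I) -> f = g.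
Proof.
move=> fg; apply/lfunP => x; rewrite (tpow_sum x) !linear_sum /=.
by apply: eq_bigr => J _; rewrite !linearZ /=; congr (_ *: _); apply/ffunP.
Qed.

Lemma tend_apply f x I : f x I = \sum_J f (tbasis C J) I * x J.
Proof.
rewrite {1}(tpow_sum x) linear_sum sum_ffunE.
by apply: eq_bigr => J _; rewrite linearZ ffunE mulrC.
Qed.

Lemma tendZ_entry a f x I : (a *: f) x I = a * f x I.
Proof. by rewrite -[a *: f]/(a *: (f : 'End(_))) scale_lfunE ffunE. Qed.

Lemma tendD_entry f g x I : (f + g) x I = f x I + g x I.
Proof. by rewrite -[f + g]/((f : 'End(_)) + g) add_lfunE ffunE. Qed.

Lemma tend_sum_entry (T : Type) (r : seq T) (P : pred T) (F : T -> tend C k m) x I :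
  (\sum_(i <- r | P i) F i) x I = \sum_(i <- r | P i) F i x I.
Proof.
elim/big_rec2: _ => [|i y1 y2 _ <-]; last by rewrite tendD_entry.
by rewrite -[0 : tend C k m]/(0 : 'End(_)) zero_lfunE ffunE.
Qed.

Lemma tendM_entry f g I J :
  (f * g) (tbasis C J) I = \sum_K f (tbasis C K) I * g (tbasis C J) K.
Proof. by rewrite tendM tend_apply. Qed.

Lemma tmap_entry A I J : tmap A (tbasis C J) I = \prod_l A l (I l) (J l).
Proof.
rewrite text_basis ffunE; apply: eq_bigr => l _.
by rewrite -colE mxE.
Qed.

Definition e0 : 'I_(1 + k) := lshift k ord0.

Lemma block1E (D : 'M[C]_k) (a b : 'I_(1 + k)) : block_mx 1%:M 0 0 D a b =
  match split a, split b with
  | inl _, inl _ => 1 | inr i, inr j => D i j | _, _ => 0 end.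
Proof.
rewrite -[a in LHS](splitK a) -[b in LHS](splitK b).
case: (split a) => i; case: (split b) => j /=.
- by rewrite block_mxEul mxE !ord1.
- by rewrite block_mxEur mxE.
- by rewrite block_mxEdl mxE.
- by rewrite block_mxEdr.
Qed.

Lemma split_e0 (a : 'I_(1 + k)) : (a == e0) = (split a : bool).
Proof.
rewrite -{1}(splitK a); case: (split a) => i /=; rewrite -val_eqE /=.
  by rewrite ord1.
by rewrite addnC addn1.
Qed.

Definition dop d : tend C k m :=
  text (fun J => [ffun I : midx k m => (valid e0 (partner d) (glue I J))%:R]).

Lemma dop_entry d I J : dop d (tbasis C J) I = (valid e0 (partner d) (glue I J))%:R.
Proof. by rewrite text_basis ffunE. Qed.

Lemma dop_mul d d' :
  dop d * dop d' = (k.+1)%:R ^+ nb_loops d d' *: dop (comp d d').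
Proof.
apply: tend_ext => I J; rewrite tendM_entry tendZ_entry.
under eq_bigr do rewrite !dop_entry -natrM mulnb.
rewrite dop_entry -natr_sum.
have := card_valid e0 d d' I J; rewrite card_ord => /(congr1 (fun n => n%:R : C)).
rewrite natrM natrX -[(1 + k)%:R]/(k.+1%:R) => <-; congr (_%:R).
by rewrite -sum1_card [RHS]big_mkcond /=; apply: eq_bigr => K _; rewrite inE; case: ifP.
Qed.

Lemma prod_bool (T : finType) (P : pred T) :
  \prod_(i : T) (P i)%:R = ([forall i, P i])%:R :> C.
Proof.
have [/forallP H|/forallPn[i Pi]] := boolP [forall i, P i].
  by rewrite big1 // => i _; rewrite H.
by rewrite (bigD1 i) //= (negbTE Pi) mul0r.
Qed.

Lemma dop_perm s : dop (perm_diag s) = Sact C k s.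
Proof.
apply: tend_ext => I J; rewrite dop_entry text_basis ffunE.
under eq_bigr do rewrite mxE andbT.
rewrite prod_bool; congr (_%:R); congr nat_of_bool.
apply/valid_permP/forallP => [H i|H i].
  by rewrite -H permKV.
by have /eqP := H (s i); rewrite permK.
Qed.

Lemma dop_u i : dop (u_diag i) = eps C k i.
Proof.
apply: tend_ext => I J; rewrite dop_entry tmap_entry.
rewrite (eq_bigr (fun l => (if l == i then (I l == e0) && (J l == e0)
    else I l == J l)%:R)) => [|l _]; last first.
  case: ifP => _; last by rewrite mxE.
  rewrite block1E !split_e0; case: (split (I l)) => ?; case: (split (J l)) => ? //.
  by rewrite mxE.
rewrite prod_bool; congr (_%:R); congr nat_of_bool.
apply/valid_uP/forallP => [[Ii Ji H] l|H].
  by case: eqVneq => [->|li]; rewrite ?Ii ?Ji ?eqxx // H.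
have := H i; rewrite eqxx => /andP[/eqP Ii /eqP Ji]; split=> // l li.
by have := H l; rewrite (negbTE li) => /eqP.
Qed.

Lemma dop_p i j : i != j -> dop (p_diag i j) = zeta C k i j.
Proof.
move=> ij; apply: tend_ext => I J; rewrite dop_entry text_basis ffunE sum_ffunE.
pose Q s := [forall l, I l == (if (l == i) || (l == j) then s else J l)].
rewrite (eq_bigr (fun s => (Q s)%:R)) => [|s _]; last first.
  by rewrite ffunE; under eq_bigr do rewrite mxE andbT; rewrite prod_bool.
have [v|nv] := boolP (valid _ _ _).
  have [Iij Jij H] := valid_pP _ _ _ ij v.
  rewrite Jij eqxx (bigD1 (I i)) //= big1 => [|s sI].
    rewrite (_ : Q _ = true) ?addr0 ?[_ *: _]mulr1 //; apply/forallP => l.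
    have [->|li] := eqVneq l i; first by [].
    have [->|lj] := eqVneq l j; first by rewrite /= Iij.
    by rewrite /= H.
  rewrite (_ : Q _ = false) //; apply/negbTE/forallPn; exists i.
  by rewrite eqxx eq_sym.
have [Jij|] := eqVneq (J i) (J j); last by rewrite [_ *: _]mul0r.
rewrite big1 ?[_ *: _]mulr0 // => s _; rewrite (_ : Q _ = false) //.
apply: contraNF nv => /forallP H; apply/valid_pP => //; split=> //.
  by have := H i; have := H j; rewrite !eqxx orbT => /eqP-> /eqP->.
by move=> l li lj; have /eqP := H l; rewrite (negbTE li) (negbTE lj).
Qed.

Lemma dop1 : dop (perm_diag 1%g) = 1.
Proof.
apply: tend_ext => I J; rewrite dop_entry tend1 tbasisE; congr (_%:R).
congr nat_of_bool; apply/valid_permP/eqP => [H|-> i]; last by rewrite perm1.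
by apply/ffunP => i; rewrite -H perm1.
Qed.

End Operators.

(** * Orthogonal projections *)

Lemma span_ind (K : fieldType) (V : vectType K) (P : V -> Prop) (s : seq V) :
  P 0 -> (forall a x y, P x -> P y -> P (a *: x + y)) ->
  (forall x, x \in s -> P x) -> forall x, x \in <<s>>%VS -> P x.
Proof.
move=> P0 PD Ps x /(@coord_span _ _ _ (in_tuple s)) ->.
elim/big_ind: _ => // [y z Py Pz|i _]; first by rewrite -[y]scale1r; apply: PD.
rewrite -[_ *: _]addr0; apply: PD => //; apply: Ps.
by rewrite -tnth_nth mem_tnth.
Qed.

Section Hermitian.

Variables (C : numClosedFieldType) (X : finType).

Local Notation V := {ffun X -> C^o}.
Implicit Types x y u v : V.

Definition dot x y : C := \sum_i x i * (y i)^*.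

Lemma dotDl a x y u : dot (a *: x + y) u = a * dot x u + dot y u.
Proof.
rewrite /dot mulr_sumr -big_split; apply: eq_bigr => i _.
by rewrite !ffunE mulrDl -mulrA.
Qed.

Lemma dotDr a x y u : dot u (a *: x + y) = a^* * dot u x + dot u y.
Proof.
rewrite /dot mulr_sumr -big_split; apply: eq_bigr => i _.
by rewrite !ffunE rmorphD rmorphM mulrDr mulrCA.
Qed.

Lemma dot0r u : dot u 0 = 0.
Proof. by rewrite /dot big1 // => i _; rewrite ffunE rmorph0 mulr0. Qed.

Lemma dot0l u : dot 0 u = 0.
Proof. by rewrite /dot big1 // => i _; rewrite ffunE mul0r. Qed.

Lemma dotC u v : dot u v = (dot v u)^*.
Proof.
rewrite /dot rmorph_sum; apply: eq_bigr => i _.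
by rewrite rmorphM /= conjCK mulrC.
Qed.

Lemma dot_eq0 x : dot x x = 0 -> x = 0.
Proof.
move=> /eqP; rewrite psumr_eq0 => [/allP H|i _]; last by rewrite -normCK exprn_ge0.
apply/ffunP => i; rewrite ffunE; apply/eqP.
by have := H i (mem_index_enum _); rewrite -normCK expf_eq0 normr_eq0.
Qed.

(** Gram-Schmidt, one vector of the list at a time. The projection is built as a linear map because
    the double commutant argument cuts it into blocks. *)
Lemma orth_proj (s : seq V) : exists P : 'End(V), forall x,
  P x \in <<s>>%VS /\ forall u, u \in <<s>>%VS -> dot (x - P x) u = 0.
Proof.
elim: s => [|e s [P HP]].
  exists 0 => x; split=> [|u]; first by rewrite lfunE mem0v.
  by rewrite span_nil memv0 => /eqP->; rewrite dot0r.
pose e' := e - P e; pose Q x := P x + (dot x e' / dot e' e') *: e'.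
have [Pe eo] := HP e.
have linQ : linear Q.
  move=> a x y; rewrite /Q linearP /= dotDl mulrDl scalerDl -mulrA -scalerA [a *:
    (P x + _)]scalerDr.
  by rewrite addrACA.
pose lQ : {linear V -> V} := HB.pack Q (GRing.isLinear.Build C V V _ Q linQ).
have sV u : u \in <<s>>%VS -> u \in <<e :: s>>%VS.
  by rewrite span_cons; apply/subvP/addvSr.
have e'V : e' \in <<e :: s>>%VS by apply: memvB; [apply/memv_span/mem_head|apply: sV].
exists (linfun lQ) => x; have [Px xo] := HP x.
rewrite lfunE /=; split; first by apply: memvD; [apply: sV|apply: memvZ].
have [Pxs Pxo] := HP x.
have oe' : dot (x - Q x) e' = 0.
  have -> : x - Q x = - (dot x e' / dot e' e') *: e' + (x - P x).
    by rewrite /Q opprD addrA scaleNr addrC.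
  rewrite dotDl mulNr.
  (* The list need not be free: [e'] vanishes when [e] already lies in the span of [s]. *)
  have [e0|ne0] := eqVneq (dot e' e') 0.
    by rewrite (dot_eq0 e0) !dot0r mulr0 oppr0 addr0.
  rewrite divfK // -[x]scale1r dotDl scale1r -scaleN1r -[_ *: P x]addr0 dotDl.
  by rewrite [dot (P x) _]dotC eo // dot0l mul1r conjC0 mulr0 !addr0 addNr.
move=> u; rewrite span_cons => /memv_addP[v /vlineP[a ->] [t ts ->]].
have -> : a *: e + t = a *: e' + (a *: P e + t) by rewrite /e' scalerBr addrA subrK.
rewrite dotDr oe' mulr0 add0r.
have -> : x - Q x = - (dot x e' / dot e' e') *: e' + (x - P x).
  by rewrite /Q opprD addrA scaleNr addrC.
have aPt : a *: P e + t \in <<s>>%VS by apply: memvD => //; apply: memvZ.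
by rewrite dotDl (eo _ aPt) (Pxo _ aPt) mulr0 addr0.
Qed.

End Hermitian.

(** * Invariant tensors *)

Section Update.

Variables (T : finType) (L : eqType).
Implicit Types (I : {ffun T -> L}) (a b : T) (i j s t : L).

Definition upd I a s : {ffun T -> L} := [ffun x => if x == a then s else I x].

Lemma upd_same I a : upd I a (I a) = I.
Proof. by apply/ffunP => x; rewrite ffunE; case: eqP => [->|]. Qed.

Lemma upd_upd I a s t : upd (upd I a s) a t = upd I a t.
Proof. by apply/ffunP => x; rewrite !ffunE; case: eqP. Qed.

Lemma updC I a b s t : a != b -> upd (upd I a s) b t = upd (upd I b t) a s.
Proof.
move=> ab; apply/ffunP => x; rewrite !ffunE.
by have [->|//] := eqVneq x b; rewrite eq_sym (negbTE ab).
Qed.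

Lemma upd_at I a s : upd I a s a = s.
Proof. by rewrite ffunE eqxx. Qed.

Lemma upd_off I a b s : b != a -> upd I a s b = I b.
Proof. by rewrite ffunE => /negbTE->. Qed.

End Update.

Section Tensors.

Variables (C : numClosedFieldType) (T : finType) (k : nat).

Local Notation idx := {ffun T -> 'I_k}.
Local Notation W := {ffun idx -> C^o}.
Implicit Types (I J : idx) (w : W) (a b c : T) (i j s : 'I_k) (A : {set T}).

Definition match_tensor (p : T -> T) : W :=
  [ffun I : idx => [forall v, I (p v) == I v]%:R].

(** Fixed points impose no condition in [match_tensor]. A tensor with factors in [A] is thus encoded
    as a function of all coordinates that ignores those outside [A], and a single space serves the
    whole induction on [A]. *)
Definition matching A (p : T -> T) : Prop :=
  involutive p /\ forall v, (p v == v) = (v \notin A).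

Definition matchingb A (p : {ffun T -> T}) : bool :=
  [forall v, (p (p v) == v) && ((p v == v) == (v \notin A))].

Lemma matchingP A (p : {ffun T -> T}) : reflect (matching A p) (matchingb A p).
Proof.
apply: (iffP forallP) => [H|[H1 H2] v]; last by rewrite H1 H2 !eqxx.
by split=> v; have /andP[/eqP pv /eqP] := H v.
Qed.

Definition matching_span A : {vspace W} :=
  <<[seq match_tensor p | p : {ffun T -> T} in matchingb A]>>%VS.

Lemma mem_matching_span A p : matching A p -> match_tensor p \in matching_span A.
Proof.
move=> Ap; apply: memv_span; apply/imageP; exists [ffun x => p x].
  apply/matchingP; case: Ap => H1 H2.
  by split=> v; rewrite !ffunE.
apply/ffunP => I; rewrite !ffunE; congr (_%:R); congr nat_of_bool.
by apply: eq_forallb => v; rewrite ffunE.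
Qed.

Lemma matching_span_ind A (P : W -> Prop) :
  P 0 -> (forall (z : C) x y, P x -> P y -> P (z *: x + y)) ->
  (forall p, matching A p -> P (match_tensor p)) ->
  forall x, x \in matching_span A -> P x.
Proof.
move=> P0 PD Pm; apply: span_ind => // x /imageP[p /matchingP mp ->]; exact: Pm.
Qed.

(* Invariance of a tensor in the factors of [A] under so_k and under the
   diagonal matrices with entries 1 and -1. *)
Definition invariant A w : Prop :=
  [/\ forall I a s, a \notin A -> w (upd I a s) = w I,
      forall I i j, \sum_(a in A) ((I a == i)%:R * w (upd I a j) -
                                   (I a == j)%:R * w (upd I a i)) = 0
    & forall I i, w I != 0 -> ~~ odd #|[set a in A | I a == i]|].

Lemma invariantD A (z : C) x y : invariant A x -> invariant A y -> invariant A (z *: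
  x + y).
Proof.
move=> [x1 x2 x3] [y1 y2 y3]; split=> [I b s bA|I i j|I i].
- by rewrite !ffunE x1 ?y1.
- pose F w b : C := (I b == i)%:R * w (upd I b j) - (I b == j)%:R * w (upd I b i).
  transitivity (z * \sum_(b in A) F x b + \sum_(b in A) F y b).
    rewrite mulr_sumr -big_split; apply: eq_bigr => b _.
    by rewrite /F !ffunE /GRing.scale /=; ring.
  by rewrite x2 y2 mulr0 addr0.
- rewrite !ffunE => nz; have [x0|/x3//] := eqVneq (x I) 0.
  by apply: y3; apply: contraNneq nz => ->; rewrite x0 scaler0 addr0.
Qed.

Lemma invariant0 A : invariant A 0.
Proof.
split=> [I a s _|I i j|I i]; rewrite ?ffunE ?eqxx //.
by rewrite big1 // => a _; rewrite !ffunE !mulr0 subrr.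
Qed.

(** Serves to cancel the first term at [a] of the so_k sum against the second term at [p a]. *)
Lemma match_tensor_swap A p I a i j : matching A p -> a \in A ->
  I a = i -> [forall v, upd I a j (p v) == upd I a j v] ->
  I (p a) = j /\ [forall v, upd I (p a) i (p v) == upd I (p a) i v].
Proof.
move=> [pK pA] aA Iai /forallP H; have pa : p a != a by rewrite pA aA.
have Ij : I (p a) = j by have := H a; rewrite upd_at upd_off // => /eqP.
split=> //; apply/forallP => v; rewrite !ffunE.
have [->|vpa] := eqVneq v (p a); first by rewrite pK [a == _]eq_sym (negbTE pa) Iai.
have [|pvpa] := eqVneq (p v) (p a).
  by move/(inv_inj pK)=> ->; rewrite Iai.
have va : v != a by apply: contraNneq pvpa => ->.
have pva : p v != a by apply: contraNneq vpa => <-; rewrite pK.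
by have := H v; rewrite !upd_off.
Qed.

Lemma invariant_match A p : matching A p -> invariant A (match_tensor p).
Proof.
move=> mp; have [pK pA] := mp; split=> [I a s aA|I i j|I i].
- rewrite !ffunE; congr (_%:R); congr nat_of_bool; apply: eq_forallb => v.
  have pa : p a = a by apply/eqP; rewrite pA aA.
  have [->|va] := eqVneq v a; first by rewrite pa !eqxx.
  by rewrite !upd_off // -{1}pa (inj_eq (inv_inj pK)).
- rewrite sumrB; apply/eqP; rewrite subr_eq0; apply/eqP.
  rewrite [RHS](reindex_inj (inv_inj pK)) /=.
  apply: eq_big => [v|a aA].
    by apply: negb_inj; rewrite -!pA pK eq_sym.
  rewrite !ffunE -!natrM !mulnb; congr (_%:R); congr nat_of_bool.
  have pa : p a \in A by apply: contraTT aA; rewrite -!pA pK eq_sym.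
  apply/andP/andP => -[/eqP Ia H].
    by have [-> ->] := match_tensor_swap mp aA Ia H; rewrite eqxx.
  by have := match_tensor_swap mp pa Ia H; rewrite pK => -[-> ->]; rewrite eqxx.
- rewrite ffunE; case: forallP => [H _|]; last by rewrite eqxx.
  rewrite (odd_card_invol pK) => [|a]; last first.
    rewrite !inE (eqP (H a)) => /andP[aA ->]; rewrite andbT.
    by apply: contraTT aA; rewrite -!pA pK eq_sym.
  rewrite (_ : [set a in _ | _] = set0) ?cards0 //.
  by apply/setP => a; rewrite !inE pA; case: (a \in A); rewrite //= andbF.
Qed.

Lemma matching_span_invariant A x : x \in matching_span A -> invariant A x.
Proof.
apply: matching_span_ind; [exact: invariant0|exact: invariantD|exact: invariant_match].
Qed.

Definition contract a b w : W := [ffun I : idx => \sum_s w (upd (upd I a s) b s)].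

(** Both contracted factors carry the same summation label, so the so_k terms at [a] and at [b] are
    opposite, and the multiplicity of a label in these two factors is 0 or 2. *)
Lemma invariant_contract A a b w : a \in A -> b \in A -> a != b ->
  invariant A w -> invariant (A :\ a :\ b) (contract a b w).
Proof.
move=> aA bA ab [w1 w2 w3]; have ba : b != a by rewrite eq_sym.
split=> [I c t cA|I i j|I i].
- rewrite !ffunE; apply: eq_bigr => s _.
  have [->|cb] := eqVneq c b; first by rewrite (updC _ _ _ ba) upd_upd (updC _ _ _ ab).
  have [->|ca] := eqVneq c a; first by rewrite upd_upd.
  by rewrite (updC _ _ _ ca) (updC _ _ _ cb) w1 //; move: cA; rewrite !inE cb ca.
- pose U s := upd (upd I a s) b s.
  pose F (c : T) s := (U s c == i)%:R * w (upd (U s) c j) - (U s c == j)%:R * w (upd (U s) c i).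
  transitivity (\sum_(c in A :\ a :\ b) \sum_s F c s).
    apply: eq_bigr => c; rewrite !inE => /and3P[cb ca cA].
    rewrite !ffunE sumrB !mulr_sumr; congr (_ - _); apply: eq_bigr => s _;
    by rewrite /U !upd_off // (updC _ _ _ ca) (updC _ _ _ cb).
  have H : \sum_(c in A) \sum_s F c s = 0.
    by rewrite exchange_big big1 // => s _; apply: w2.
  have aA' : a \in A :\ b by rewrite !inE ab.
  move: H; rewrite (big_setD1 b) //= (big_setD1 a) //=.
  rewrite (_ : A :\ b :\ a = A :\ a :\ b); last by apply/setP => x; rewrite !inE andbCA.
  suff -> : \sum_s F b s = - \sum_s F a s by rewrite addrA addNr add0r.
  have pick (G : 'I_k -> C) t : \sum_s (s == t)%:R * G s = G t.
    rewrite (bigD1 t) //= eqxx mul1r big1 ?addr0 // => s /negbTE->.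
    by rewrite mul0r.
  have Fb : \sum_s F b s = w (upd (upd I a i) b j) - w (upd (upd I a j) b i).
    rewrite sumrB; under eq_bigr do rewrite /U upd_at upd_upd.
    by under [X in _ - X]eq_bigr do rewrite /U upd_at upd_upd; rewrite !pick.
  have Fa : \sum_s F a s = w (upd (upd I a j) b i) - w (upd (upd I a i) b j).
    rewrite sumrB; under eq_bigr do rewrite /U (updC _ _ _ ab) upd_at upd_upd -(updC _ _ _ ab).
    under [X in _ - X]eq_bigr do rewrite /U (updC _ _ _ ab) upd_at upd_upd -(updC _ _ _ ab).
    by rewrite !pick.
  by rewrite Fa Fb opprB.
- rewrite ffunE => nz; have [s ws] : exists s, w (upd (upd I a s) b s) != 0.
    by apply/existsP; apply: contraNT nz => /existsPn H; rewrite big1 // => s _;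
      apply/eqP; have := H s; rewrite negbK.
  have := w3 _ i ws; apply: contraNN => o.
  set K := [set c in A | _].
  rewrite (cardsD1 a) (cardsD1 b) !inE !ffunE ba eqxx aA bA /=.
  rewrite (_ : K :\ a :\ b = [set c in A :\ a :\ b | I c == i]).
    by rewrite eqxx (negbTE ab) !oddD o; case: (s == i).
  apply/setP => c; rewrite !inE !ffunE.
  by have [->|cb] := eqVneq c b => //=; have [->|ca] := eqVneq c a => //=.
Qed.

End Tensors.

(** * The Casimir element of gl_k *)

Section Casimir.

Variables (C : numClosedFieldType) (T : finType) (k : nat).

Local Notation idx := {ffun T -> 'I_k}.
Local Notation W := {ffun idx -> C^o}.
Implicit Types (I J : idx) (w u v : W) (a b c : T) (i j s : 'I_k) (A : {set T}).

(** The matrix unit E_ij of gl_k acting as a derivation on the factors of [A], in coordinates. *)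
Definition gl_act A i j w : W :=
  [ffun I : idx => \sum_(b in A) (I b == i)%:R * w (upd I b j)].

(* The Casimir element of gl_k minus the number of tensor factors. *)
Definition casimir A w : W :=
  [ffun I : idx => \sum_(a in A) ((k%:R - 1) * w I +
     \sum_(b in A | b != a) w (upd (upd I a (I b)) b (I a)))].

Lemma sum_pick (G : 'I_k -> C) t : \sum_s (s == t)%:R * G s = G t.
Proof.
rewrite (bigD1 t) //= eqxx mul1r big1 ?addr0 // => s /negbTE->.
by rewrite mul0r.
Qed.

Lemma casimir_invariant A w I : invariant A w -> casimir A w I =
  \sum_(a in A) \sum_(b in A | b != a) (I a == I b)%:R * contract a b w I.
Proof.
move=> [_ inf _]; rewrite ffunE; apply: eq_bigr => a aA.
(* The so_k relation is taken at [upd I a j] for the labels [j] and [I a], and summed over [j]. The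
   term b = a gives (k - 1) w; each b != a gives the transposition of [a] and [b] minus the form
   times the contraction. *)
pose F j b : C := (upd I a j b == j)%:R * w (upd (upd I a j) b (I a)) -
  (upd I a j b == I a)%:R * w (upd (upd I a j) b j).
have : \sum_j \sum_(b in A) F j b = 0 by rewrite big1 // => j _; apply: inf.
rewrite exchange_big (bigD1 a) //=.
have -> : \sum_j F j a = (k%:R - 1) * w I.
  rewrite sumrB; under eq_bigr do rewrite upd_at eqxx mul1r upd_upd upd_same.
  under [X in _ - X]eq_bigr do rewrite upd_at upd_upd.
  by rewrite sum_pick upd_same sumr_const card_ord mulrBl mul1r mulr_natl.
move=> H; apply/eqP; rewrite -subr_eq0 -addrA -sumrB -[X in _ == X]H; apply/eqP.
congr (_ + _); apply: eq_bigr => b /andP[bA ba].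
rewrite sumrB; congr (_ - _).
  under eq_bigr do rewrite upd_off // [_ == _]eq_sym.
  by rewrite (sum_pick (fun j => w (upd (upd I a j) b (I a)))).
rewrite ffunE mulr_sumr; apply: eq_bigr => j _.
by rewrite upd_off // [I a == _]eq_sym.
Qed.

(** E_ij has adjoint E_ji: replacing [i] by [j] at position [b] is a bijection between the
    labellings with [i] there and those with [j] there. *)
Lemma gl_act_adjoint A i j u v : dot (gl_act A i j u) v = dot u (gl_act A j i v).
Proof.
rewrite /dot; under eq_bigr do rewrite ffunE mulr_suml.
under [RHS]eq_bigr do rewrite ffunE rmorph_sum mulr_sumr.
rewrite exchange_big [RHS]exchange_big; apply: eq_bigr => b _ /=.
transitivity (\sum_(I : idx | I b == i) u (upd I b j) * (v I)^*).
  rewrite [RHS]big_mkcond; apply: eq_bigr => I _.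
  by case: eqP => _; rewrite ?mul0r ?mul1r.
rewrite (reindex_onto (fun J => upd J b i) (fun I => upd I b j)) => [|I /eqP Ii];
  last first.
  by rewrite upd_upd -Ii upd_same.
rewrite big_mkcond; apply: eq_bigr => J _ /=; rewrite upd_at eqxx upd_upd /=.
rewrite rmorphM rmorph_nat mulrCA.
have [<-|nJ] := eqVneq (J b) j; first by rewrite upd_same eqxx mul1r.
rewrite mul0r ifF //; apply/negbTE; apply: contraNneq nJ => <-.
by rewrite upd_at.
Qed.

(** When both matrix units act on the same factor they contribute k w, against k - 1 in [casimir]:
    hence the shift by #|A|. *)
Lemma gl_casimir A w :
  \sum_i \sum_j gl_act A j i (gl_act A i j w) = casimir A w + #|A|%:R *: w.
Proof.
apply/ffunP => I; rewrite sum_ffunE; under eq_bigr do rewrite sum_ffunE.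
pose G i a j : C := \sum_(b in A) (upd I a i b == i)%:R * w (upd (upd I a i) b j).
transitivity (\sum_(a in A) \sum_i G i a (I a)).
  rewrite [RHS]exchange_big; apply: eq_bigr => i _ /=.
  transitivity (\sum_j \sum_(a in A) (j == I a)%:R * G i a j).
    apply: eq_bigr => j _; rewrite ffunE; apply: eq_bigr => a _.
    by rewrite ffunE eq_sym.
  by rewrite exchange_big; apply: eq_bigr => a _; rewrite (sum_pick (G i a)).
rewrite !ffunE [_ *: _]mulr_natl -sumr_const -big_split.
apply: eq_bigr => a aA; rewrite /= /G exchange_big (bigD1 a) //=.
under eq_bigr do rewrite upd_at eqxx mul1r upd_upd upd_same.
rewrite sumr_const card_ord addrAC mulrBl mul1r subrK mulr_natl; congr (_ + _).
apply: eq_bigr => b /andP[bA ba].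
under eq_bigr do rewrite upd_off // [_ == _]eq_sym.
by rewrite (sum_pick (fun i => w (upd (upd I a i) b (I a)))).
Qed.

Lemma dot_sum (U : Type) (r : seq U) (F : U -> W) v :
  dot (\sum_(x <- r) F x) v = \sum_(x <- r) dot (F x) v.
Proof.
elim/big_rec2: _ => [|x y1 y2 _ <-]; first exact: dot0l.
by rewrite -[F x]scale1r dotDl mul1r scale1r.
Qed.

Lemma dot_ge0 (w : W) : 0 <= dot w w.
Proof. by apply: sumr_ge0 => I _; rewrite -normCK exprn_ge0. Qed.

(* On the weight space with multiplicities n_i, the Casimir element is bounded
   below by the sum of the n_i ^ 2 - n_i, which is positive as the n_i are even. *)
Lemma casimir_ge A w : invariant A w ->
  #|A|%:R * dot w w <= dot (casimir A w) w.
Proof.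
move=> [_ _ ev].
have E : dot (casimir A w) w + #|A|%:R * dot w w =
    \sum_i \sum_j dot (gl_act A i j w) (gl_act A i j w).
  rewrite addrC -dotDl addrC -gl_casimir dot_sum; apply: eq_bigr => i _.
  by rewrite dot_sum; apply: eq_bigr => j _; rewrite gl_act_adjoint.
rewrite -(lerD2r (#|A|%:R * dot w w)) E.
(* Only the diagonal terms are kept: E_ii multiplies [w I] by the multiplicity n_i, an even n_i
   satisfies n_i ^ 2 >= 2 n_i, and the n_i add up to #|A|. *)
apply: (@le_trans _ _ (\sum_i dot (gl_act A i i w) (gl_act A i i w))); last first.
  apply: ler_sum => i _; rewrite [leRHS](bigD1 i) //= lerDl.
  by apply: sumr_ge0 => j _; apply: dot_ge0.
rewrite /dot exchange_big -mulr2n -mulrnAl mulr_sumr /=; apply: ler_sum => I _.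
have glE i : gl_act A i i w I = #|[set a in A | I a == i]|%:R * w I.
  rewrite ffunE -sum1_card natr_sum mulr_suml big_mkcond [RHS]big_mkcond /=.
  apply: eq_bigr => a _; rewrite inE; case: (a \in A) => //=.
  by case: eqP => [<-|_]; rewrite ?upd_same ?mul0r ?mul1r.
under [leRHS]eq_bigr do rewrite glE rmorphM rmorph_nat mulrACA.
rewrite -mulr_suml -normCK; have [w0|nw] := eqVneq (w I) 0.
  by rewrite w0 normr0 expr0n !mulr0.
rewrite ler_wpM2r ?exprn_ge0 // -mulrnA.
under eq_bigr do rewrite -natrM; rewrite -natr_sum ler_nat.
have -> : #|A| = \sum_i #|[set a in A | I a == i]|.
  rewrite -sum1_card (partition_big I predT) //=; apply: eq_bigr => i _.
  by rewrite -sum1_card; apply: eq_bigl => a; rewrite inE.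
rewrite big_distrl; apply: leq_sum => i _ /=.
have := ev I i nw; case: #|_| => [|[|n]] // _; nia.
Qed.

End Casimir.

(** * First fundamental theorem on the tensor powers of V *)

Section FFT.

Variables (C : numClosedFieldType) (T : finType) (k : nat).

Local Notation idx := {ffun T -> 'I_k}.
Local Notation W := {ffun idx -> C^o}.
Implicit Types (I J : idx) (w : W) (a b c : T) (i j s : 'I_k) (A : {set T}).

Lemma upd_invariant_const w : (forall I a s, w (upd I a s) = w I) ->
  forall I J, w I = w J.
Proof.
move=> H I J; have [n] := ubnP #|[set a | I a != J a]|.
elim: n I => // n IHn I ltn.
have [/existsP[a nIJ]|/existsPn e] := boolP [exists a, I a != J a]; last first.
  by congr (w _); apply/ffunP => a; apply/eqP; have := e a; rewrite negbK.
rewrite -(H I a (J a)); apply: IHn; apply: leq_trans (ltn : (_ <= n)%N).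
apply: proper_card; apply/properP; split; last by exists a; rewrite !inE ?upd_at ?eqxx.
by apply/subsetP => b; rewrite !inE ffunE; have [->|//] := eqVneq b a; rewrite eqxx.
Qed.

Lemma matching_join A a b (p : T -> T) : a \in A -> b \in A -> a != b ->
  matching (A :\ a :\ b) p ->
  exists2 q, matching A q & forall I : idx,
    (I a == I b)%:R * match_tensor C k p I = match_tensor C k q I.
Proof.
move=> aA bA ab [pK pA]; have ba : b != a by rewrite eq_sym.
have pa : p a = a by apply/eqP; rewrite pA !inE ab eqxx.
have pb : p b = b by apply/eqP; rewrite pA !inE eqxx.
pose q v := if v == a then b else if v == b then a else p v.
have qa : q a = b by rewrite /q eqxx.
have qb : q b = a by rewrite /q (negbTE ba) eqxx.
have qp v : v != a -> v != b -> q v = p v by rewrite /q => /negbTE-> /negbTE->.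
have pNa v : v != a -> p v != a by move=> va; rewrite -pa (inj_eq (inv_inj pK)).
have pNb v : v != b -> p v != b by move=> vb; rewrite -pb (inj_eq (inv_inj pK)).
exists q.
  split=> v.
    have [->|va] := eqVneq v a; first by rewrite qa qb.
    have [->|vb] := eqVneq v b; first by rewrite qb qa.
    by rewrite (qp v) // qp ?pNa ?pNb // pK.
  have [->|va] := eqVneq v a; first by rewrite qa aA (negbTE ba).
  have [->|vb] := eqVneq v b; first by rewrite qb bA (negbTE ab).
  by rewrite qp // pA !inE va vb.
move=> I; rewrite !ffunE -natrM mulnb; congr (_%:R); congr nat_of_bool.
apply/andP/forallP => [[/eqP Iab /forallP H] v|H].
  have [->|va] := eqVneq v a; first by rewrite qa Iab.
  have [->|vb] := eqVneq v b; first by rewrite qb Iab.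
  by rewrite qp.
split; first by have := H b; rewrite qb.
apply/forallP => v; have [->|va] := eqVneq v a; first by rewrite pa.
have [->|vb] := eqVneq v b; first by rewrite pb.
by rewrite -qp.
Qed.

Lemma matching_span_join A a b x : a \in A -> b \in A -> a != b ->
  x \in matching_span C k (A :\ a :\ b) ->
  [ffun I : idx => (I a == I b)%:R * x I : C^o] \in matching_span C k A.
Proof.
move=> aA bA ab; apply: (@matching_span_ind C T k _
  (fun x => [ffun I : idx => (I a == I b)%:R * x I : C^o] \in matching_span C k A)).
- rewrite (_ : finfun _ = 0) ?mem0v //; apply/ffunP => I; rewrite !ffunE mulr0 //.
- move=> z y t yM tM.
  rewrite (_ : finfun _ = z *: [ffun I : idx => (I a == I b)%:R * y I : C^o] +
    [ffun I : idx => (I a == I b)%:R * t I : C^o]); first by rewrite memvD ?memvZ.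
  by apply/ffunP => I; rewrite !ffunE mulrDr mulrCA.
- move=> p /(matching_join aA bA ab)[q mq E].
  rewrite (_ : finfun _ = match_tensor C k q) ?mem_matching_span //.
  by apply/ffunP => I; rewrite ffunE E.
Qed.

(** Each contraction removes two factors. For an odd number of factors there is no matching, and the
    same argument shows that w = 0. *)
Theorem invariant_matching_span A w : invariant A w -> w \in matching_span C k A.
Proof.
have [n] := ubnP #|A|; elim: n A w => // n IHn A w ltn inv.
have [A0|/set0Pn[a0 a0A]] := eqVneq A set0.
  have [w1 _ _] := inv.
  have wc := upd_invariant_const (fun I a s => w1 I a s (negbT _)).
  have id_in : match_tensor C k id \in matching_span C k A.
    by apply: mem_matching_span; split=> // v; rewrite eqxx A0 inE.
  (* There may be no multi-index at all, when k = 0; the tensor space is then zero. *)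
  have [/existsP[I0 _]|/existsPn noI] := boolP [exists I : idx, true].
    rewrite (_ : w = w I0 *: match_tensor C k id) ?memvZ //.
    apply/ffunP => I; rewrite !ffunE; case: forallP => [_|[]//].
    by rewrite [_ *: _]mulr1; apply: wc => *; rewrite A0 inE.
  by rewrite (_ : w = 0) ?mem0v //; apply/ffunP => I; have := noI I.
have [P HP] := orth_proj [seq match_tensor C k p | p : {ffun T -> T} in matchingb A].
have [Pw wo] := HP w; set v := w - P w in wo.
suff v0 : v = 0 by have /eqP := v0; rewrite subr_eq0 => /eqP->.
have invv : invariant A v.
  rewrite /v addrC -scaleN1r; apply: invariantD => //.
  exact: matching_span_invariant.
have cv : casimir A v \in matching_span C k A.
  rewrite (_ : casimir A v = \sum_(a in A) \sum_(b in A | b != a)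
     [ffun I : idx => (I a == I b)%:R * contract a b v I : C^o]).
    apply: memv_suml => a aA; apply: memv_suml => b /andP[bA ba].
    have ab : a != b by rewrite eq_sym.
    apply: matching_span_join => //; apply: IHn; last exact: invariant_contract.
    by rewrite (cardsD1 a) aA (cardsD1 b) !inE ba bA in ltn; lia.
  apply/ffunP => I; rewrite casimir_invariant // sum_ffunE; apply: eq_bigr => a _.
  by rewrite sum_ffunE; apply: eq_bigr => b _; rewrite [RHS]ffunE.
(* [v] is orthogonal to a span that contains its own Casimir image, so #|A| times its squared norm
   is at most 0. *)
have := casimir_ge invv; rewrite [dot (casimir _ _) _]dotC (wo _ cv) conjC0 => le0.
have cA : 0 < #|A|%:R :> C by rewrite ltr0n; apply/card_gt0P; exists a0.
apply: dot_eq0; apply/eqP; rewrite eq_le dot_ge0 andbT.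
by rewrite -(pmulr_rle0 _ cA).
Qed.

End FFT.

(** * From O_k to so_k *)

Lemma coef0_prod_seq (R : comNzRingType) (T : Type) (r : seq T) (P : pred T) (p : T ->
  {poly R}) :
  (\prod_(v <- r | P v) p v)`_0 = \prod_(v <- r | P v) (p v)`_0.
Proof. by elim/big_rec2: _ => [|v y1 y2 _ <-]; rewrite ?coef1 ?coef0M. Qed.

(** The Leibniz rule for the derivative at 0. *)
Lemma coef1_prod (R : comNzRingType) (T : finType) (p : T -> {poly R}) :
  (\prod_v p v)`_1 = \sum_v (p v)`_1 * \prod_(u | u != v) (p u)`_0.
Proof.
have := index_enum_uniq T; elim: (index_enum T) => [|x r IHr] /=.
  by rewrite !big_nil coef1.
case/andP=> xr /IHr{}IHr; rewrite !big_cons coefM big_ord_recr big_ord1 /= eqxx.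
rewrite IHr coef0_prod_seq addrC; congr (_ * _ + _).
  rewrite [RHS]big_seq_cond [LHS]big_seq; apply: eq_bigl => u.
  by rewrite andbC; case: eqVneq => [->|] //=; rewrite ?(negbTE xr).
rewrite mulr_sumr !big_seq; apply: eq_bigr => v vr.
have xv : x != v by apply: contraNneq xr => ->.
by rewrite big_cons xv mulrCA.
Qed.

Lemma poly_nat_roots_eq0 (C : numFieldType) (p : {poly C}) :
  (forall n : nat, p.[n%:R] = 0) -> p = 0.
Proof.
move=> H; apply: (@roots_geq_poly_eq0 _ p [seq n%:R | n <- iota 0 (size p)]).
- by apply/allP => _ /mapP[n _ ->]; apply/rootP.
- by rewrite map_inj_uniq ?iota_uniq // => a b /eqP; rewrite eqr_nat => /eqP.
- by rewrite size_map size_iota.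
Qed.

Lemma orthogonalP (C : fieldType) k (g : 'M[C]_k) : orthogonal g <-> g^T *m g = 1%:M.
Proof.
have formE u v : form u v = (u^T *m v) 0 0 :> C.
  by rewrite mxE; apply: eq_bigr => i _; rewrite mxE.
split=> [H|H u v]; last by rewrite !formE trmx_mul mulmxA -(mulmxA u^T) H mulmx1.
apply/matrixP => i j; have := H (delta_mx i 0) (delta_mx j 0).
rewrite !formE trmx_mul mulmxA -(mulmxA _ g^T) trmx_delta -rowE -colE -rowE !mxE.
by rewrite andbT => ->; rewrite eq_sym.
Qed.

Section Labels.

Variables (C : fieldType) (k : nat).
Implicit Types (i j : 'I_k) (a b : 'I_(1 + k)).

Definition r1 i : 'I_(1 + k) := rshift 1 i.

Definition Obar (g : 'M[C]_k) : 'M[C]_(1 + k) := block_mx 1%:M 0 0 g.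

Variant label_spec a : Prop :=
  | LabelZero of a = e0 k | LabelPos i of a = r1 i.

Lemma labelP a : label_spec a.
Proof.
rewrite -(splitK a); case: (split a) => i /=; last by right with i.
by left; rewrite /e0 ord1.
Qed.

Lemma r1_e0 i : (r1 i == e0 k) = false.
Proof. exact: eq_rlshift. Qed.

Lemma e0_r1 i : (e0 k == r1 i) = false.
Proof. exact: eq_lrshift. Qed.

Lemma r1_eq i j : (r1 i == r1 j) = (i == j).
Proof. exact: eq_rshift. Qed.

Lemma ObarE g : [/\ Obar g (e0 k) (e0 k) = 1, forall j, Obar g (e0 k) (r1 j) = 0,
  forall i, Obar g (r1 i) (e0 k) = 0 & forall i j, Obar g (r1 i) (r1 j) = g i j].
Proof.
rewrite /Obar; split=> [|j|i|i j].
- by rewrite block_mxEul mxE.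
- by rewrite block_mxEur mxE.
- by rewrite block_mxEdl mxE.
- by rewrite block_mxEdr.
Qed.

End Labels.

Section OrthogonalInvariants.

Variables (C : numClosedFieldType) (k : nat) (T : finType).

Local Notation idx := {ffun T -> 'I_(1 + k)}.
Implicit Types (phi kappa : idx) (F : {ffun idx -> C^o}) (i j : 'I_k).

Definition tensor_act (h : 'M[C]_(1 + k)) F : {ffun idx -> C^o} :=
  [ffun phi : idx => \sum_(kappa : idx) (\prod_v h (phi v) (kappa v)) * F kappa].

Variable F : {ffun idx -> C^o}.
Hypothesis F_inv : forall g, orthogonal g -> tensor_act (Obar g) F = F.

(** The reflection that changes the sign of e_i multiplies the coordinate [F phi] by -1 to the power
    of this multiplicity. *)
Lemma even_label phi i : F phi != 0 -> ~~ odd #|[set v | phi v == r1 i]|.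
Proof.
move=> nz; pose s (a : 'I_(1 + k)) : C := (-1) ^+ (a == r1 i).
pose g : 'M[C]_k := diag_mx (\row_j (-1) ^+ (j == i)).
have og : orthogonal g.
  apply/orthogonalP; rewrite tr_diag_mx mulmx_diag -[1%:M]diag_const_mx.
  by congr diag_mx; apply/rowP => j; rewrite !mxE -expr2 sqrr_sign.
have gE a b : Obar g a b = (a == b)%:R * s a.
  have [E1 E2 E3 E4] := ObarE g; rewrite /s.
  case: (labelP a) => [->|x ->]; case: (labelP b) => [->|y ->].
  - by rewrite E1 eqxx e0_r1 mulr1.
  - by rewrite E2 e0_r1 mul0r.
  - by rewrite E3 r1_e0 mul0r.
  - by rewrite E4 !r1_eq !mxE; rewrite mulr_natl; have [->|] := eqVneq x y.
have /ffunP/(_ phi) := F_inv og.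
rewrite ffunE (bigD1 phi) //= [X in _ + X]big1 ?addr0 => [|kappa nk]; last first.
  have [v nv] : exists v, phi v != kappa v.
    apply/existsP; apply: contraNT nk => /existsPn H; apply/eqP/ffunP => v.
    by apply/esym/eqP; have := H v; rewrite negbK.
  by rewrite (bigD1 v) //= gE (negbTE nv) !mul0r.
under eq_bigr do rewrite gE eqxx mul1r.
rewrite -expr_sum -sum1_card => E; move: E.
rewrite (_ : \sum_v _ = \sum_(v in [set v | phi v == r1 i]) 1)%N; last first.
  by rewrite big_mkcond [RHS]big_mkcond; apply: eq_bigr => v _; rewrite inE; case: eqP.
rewrite -signr_odd; case: odd => //; rewrite expr1 mulN1r => /esym/eqP.
by rewrite -addr_eq0 -mulr2n mulrn_eq0 /= (negbTE nz).
Qed.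

Definition plane_mx i j : 'M[C]_k := delta_mx i i + delta_mx j j.
Definition skew_mx i j : 'M[C]_k := delta_mx i j - delta_mx j i.

(** For x = cos - 1 and y = sin the condition is cos^2 + sin^2 = 1. With P and S the two matrices,
    S^2 = - P and P S = S P = S, so (1 + x P - y S)(1 + x P + y S) = 1 + (2 x + x^2 + y^2) P. *)
Lemma rotation_orthogonal i j (x y : C) : i != j -> x *+ 2 + x ^+ 2 + y ^+ 2 = 0 ->
  orthogonal (1%:M + x *: plane_mx i j + y *: skew_mx i j).
Proof.
move=> ij xy; apply/orthogonalP; have ji : (j == i) = false by rewrite eq_sym (negbTE ij).
set P := plane_mx i j; set S := skew_mx i j.
have dE := @mul_delta_mx_cond C k k k.
have PP : P *m P = P.
  by rewrite /P /plane_mx mulmxDl !mulmxDr !dE !eqxx ji (negbTE ij) !mulr0n !mulr1n add0r addr0.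
have PS : P *m S = S.
  by rewrite /P /S /plane_mx mulmxDl !mulmxBr !dE !eqxx ji (negbTE ij) !mulr0n !mulr1n subr0 sub0r.
have SP : S *m P = S.
  by rewrite /P /S /plane_mx mulmxBl !mulmxDr !dE !eqxx ji (negbTE ij) !mulr0n !mulr1n add0r addr0.
have SS : S *m S = - P.
  rewrite /P /S /skew_mx mulmxBl !mulmxBr !dE !eqxx ji (negbTE ij) !mulr0n !mulr1n.
  by rewrite subr0 !sub0r opprD.
have PT : P^T = P by rewrite /P /plane_mx linearD /= !trmx_delta.
have ST : S^T = - S by rewrite /S /skew_mx linearB /= !trmx_delta opprB.
clearbody P S; rewrite !raddfD /= trmx1 !linearZ /= PT ST.
rewrite mulmx1 !mulmxDl !mul1mx -!scalemxAl !mulNmx PP PS SP SS.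
apply/matrixP => a b; rewrite !mxE.
transitivity ((a == b)%:R + P a b * (x *+ 2 + x ^+ 2 + y ^+ 2)); first by ring.
by rewrite xy mulr0 addr0.
Qed.

Definition rot_coef i j (a b : 'I_(1 + k)) : C :=
  ((a == r1 i) && (b == r1 j))%:R - ((a == r1 j) && (b == r1 i))%:R.

Definition plane_coef i j (a b : 'I_(1 + k)) : C :=
  ((a == r1 i) && (b == r1 i))%:R + ((a == r1 j) && (b == r1 j))%:R.

(* [rot_poly] is [1 + t ^ 2] times the rotation with cosine
   [(1 - t ^ 2) / (1 + t ^ 2)] and sine [2 t / (1 + t ^ 2)]. *)
Definition rot_poly i j (a b : 'I_(1 + k)) : {poly C} :=
  ((a == b)%:R)%:P * (1 + 'X^2) - (plane_coef i j a b *+ 2)%:P * 'X^2 +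
  (rot_coef i j a b *+ 2)%:P * 'X.

Definition rotation i j (t : C) : 'M[C]_k :=
  1%:M + (- (t ^+ 2 *+ 2) / (1 + t ^+ 2)) *: plane_mx i j +
  (t *+ 2 / (1 + t ^+ 2)) *: skew_mx i j.

Lemma rot_polyE i j t a b : 1 + t ^+ 2 != 0 ->
  (rot_poly i j a b).[t] = (1 + t ^+ 2) * Obar (rotation i j t) a b.
Proof.
move=> nz; rewrite /rot_poly !(hornerD, hornerN, hornerM, hornerC, hornerXn, hornerX) /plane_coef /rot_coef.
have [E1 E2 E3 E4] := ObarE (rotation i j t).
case: (labelP a) => [->|x ->]; case: (labelP b) => [->|y ->].
- by rewrite E1 eqxx !e0_r1 /=; ring.
- by rewrite E2 !e0_r1 /=; ring.
- by rewrite E3 !r1_e0 !andbF /=; ring.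
- by rewrite E4 !r1_eq !mxE; field.
Qed.

Lemma rot_poly0 i j a b : (rot_poly i j a b)`_0 = (a == b)%:R.
Proof. by rewrite -horner_coef0 /rot_poly !(hornerD, hornerN, hornerM, hornerC, hornerXn, hornerX); ring. Qed.

Lemma rot_poly1 i j a b : (rot_poly i j a b)`_1 = rot_coef i j a b *+ 2.
Proof.
rewrite /rot_poly !coefD coefN !coefCM coefD coef1 coefX coefXn /=.
by rewrite addr0 !mulr0 subr0 add0r mulr1.
Qed.

(** Invariance under rotations, cleared of denominators, is a polynomial identity in t; its
    coefficient of degree 1 is the derivative at the identity. *)
Lemma infinitesimal phi i j :
  \sum_v ((phi v == r1 i)%:R * F (upd phi v (r1 j)) -
          (phi v == r1 j)%:R * F (upd phi v (r1 i))) = 0.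
Proof.
have [->|ij] := eqVneq i j; first by rewrite big1 // => v _; rewrite subrr.
pose Q : {poly C} := \sum_(kappa :
  idx) (\prod_v rot_poly i j (phi v) (kappa v)) * (F kappa)%:P.
(* Natural values of t are enough in characteristic 0, and they avoid the poles, as 1 + n^2 is
   nonzero. *)
have QE : Q = (1 + 'X^2) ^+ #|T| * (F phi)%:P.
  apply/eqP; rewrite -subr_eq0; apply/eqP/poly_nat_roots_eq0 => n.
  have nz : 1 + n%:R ^+ 2 != 0 :> C by rewrite -natrX -[1]/(1%:R) -natrD pnatr_eq0.
  have og : orthogonal (rotation i j n%:R).
    by apply: rotation_orthogonal => //; field.
  rewrite !(hornerD, hornerN, hornerM, hornerC, horner_exp, hornerXn, hornerX) horner_sum; apply/eqP; rewrite subr_eq0; apply/eqP.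
  rewrite -[F phi in RHS](congr1 (fun G : {ffun _ ->
    _} => G phi) (F_inv og)) ffunE mulr_sumr.
  apply: eq_bigr => kappa _;
    rewrite hornerM hornerC horner_prod mulrA -prodr_const -big_split.
  by congr (_ * _); apply: eq_bigr => v _; rewrite rot_polyE.
have : Q`_1 = 0.
  rewrite QE coefMC.
  suff -> : ((1 + 'X^2) ^+ #|T| : {poly C})`_1 = 0 by rewrite mul0r.
  rewrite -prodr_const big_mkcond /= coef1_prod big1 // => v _.
  by rewrite coefD coef1 coefXn /= addr0 mul0r.
rewrite coef_sum; under eq_bigr do rewrite coefMC coef1_prod mulr_suml.
rewrite exchange_big /= => H; apply/eqP.
(* The sine 2 t / (1 + t^2) has derivative 2 at 0, so it is twice the sum that appears. *)
rewrite -[_ == 0]/((2 == 0)%N || (_ == 0)) -mulrn_eq0 -sumrMnl.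
rewrite -[X in _ == X]H; apply/eqP; apply: eq_bigr => v _.
have dE (kappa : idx) : \prod_(u | u != v) (rot_poly i j (phi u) (kappa u))`_0 =
    (kappa == upd phi v (kappa v))%:R.
  under eq_bigr do rewrite rot_poly0.
  have [->|/eqP nk] := eqVneq kappa (upd phi v (kappa v)).
    by rewrite big1 // => u uv; rewrite upd_off // eqxx.
  have [u uv nu] : exists2 u, u != v & phi u != kappa u.
    apply/exists_inP; apply: contra_notT nk => /exists_inPn H'.
    apply/ffunP => u; rewrite ffunE; have [->//|/H'] := eqVneq u v.
    by rewrite negbK => /eqP.
  by rewrite (bigD1 u) //= (negbTE nu) mul0r.
rewrite (partition_big (fun kappa : idx => kappa v) predT) //=.
transitivity (\sum_s rot_coef i j (phi v) s *+ 2 * F (upd phi v s)).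
  rewrite (bigD1 (r1 i)) // (bigD1 (r1 j)) /=; last by rewrite r1_eq eq_sym.
  rewrite big1 ?addr0 => [|s /andP[si sj]].
    by rewrite /rot_coef !eqxx !r1_eq [j == i]eq_sym (negbTE ij) !andbT !andbF /=; ring.
  by rewrite /rot_coef (negbTE si) (negbTE sj) !andbF subrr mul0rn mul0r.
apply: eq_bigr => s _; rewrite (bigD1 (upd phi v s)) ?upd_at //=.
rewrite dE rot_poly1 upd_at eqxx mulr1 big1 ?addr0 // => kappa /andP[/eqP <- nk].
by rewrite dE eq_sym in nk *; rewrite (negbTE nk) mulr0 mul0r.
Qed.

End OrthogonalInvariants.

(** * Reduction from the trivial summand *)

Section Restriction.

Variables (C : numClosedFieldType) (k : nat) (T : finType) (i0 : 'I_k).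

Local Notation idx := {ffun T -> 'I_(1 + k)}.
Local Notation W := {ffun idx -> C^o}.
Implicit Types (phi : idx) (F : W) (Z : {set T}) (p q : {ffun T -> T}).

Definition extend Z (I : {ffun T -> 'I_k}) : idx :=
  [ffun v => if v \in Z then e0 k else r1 (I v)].

Definition zeros phi : {set T} := [set v | phi v == e0 k].

Definition shrink phi : {ffun T -> 'I_k} :=
  [ffun v => if split (phi v) is inr i then i else i0].

Lemma shrinkK phi : extend (zeros phi) (shrink phi) = phi.
Proof.
apply/ffunP => v; rewrite !ffunE inE.
case: (labelP (phi v)) => [->|i ->]; first by rewrite eqxx.
by rewrite r1_e0 -[r1 i]/(unsplit (inr i : 'I_1 + 'I_k)) unsplitK.
Qed.

Lemma r1_inj : injective (@r1 k).
Proof. exact: rshift_inj. Qed.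

(** [extend] ignores the values of [I] on [Z], as the encoding of tensors with factors in the
    complement of [Z] requires. *)
Definition restrict F Z : {ffun {ffun T -> 'I_k} -> C^o} :=
  [ffun I : {ffun T -> 'I_k} => F (extend Z I)].

Lemma extend_upd Z I a s : a \notin Z -> extend Z (upd I a s) = upd (extend Z I) a (r1 s).
Proof.
move=> aZ; apply/ffunP => v; rewrite !ffunE.
by have [->|] := eqVneq v a => //; rewrite (negbTE aZ).
Qed.

Lemma restrict_invariant F Z :
  (forall g, orthogonal g -> tensor_act (Obar g) F = F) -> invariant (~:
    Z) (restrict F Z).
Proof.
move=> Finv; split=> [I a s|I i j|I i].
- rewrite inE negbK => aZ; rewrite !ffunE; congr (F _); apply/ffunP => v; rewrite !ffunE.
  by case: ifPn => // vZ; rewrite ifN //; apply: contraNneq vZ => ->.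
- rewrite -[RHS](infinitesimal Finv (extend Z I) i j) big_mkcond; apply: eq_bigr => v _.
  rewrite !inE; case: ifPn => vZ; last first.
    by rewrite negbK in vZ; rewrite !ffunE vZ !e0_r1 !mul0r subrr.
  by rewrite ![restrict _ _ _]ffunE !extend_upd // ![extend _ _ _]ffunE (negbTE vZ) !r1_eq.
- rewrite ffunE => /(even_label Finv)-/(_ i); congr (~~ odd _); apply: eq_card => v.
  rewrite !inE ffunE; case: (v \in Z); first by rewrite e0_r1.
  by rewrite r1_eq.
Qed.

Definition embed Z (w : {ffun {ffun T -> 'I_k} -> C^o}) : W :=
  [ffun phi : idx => (zeros phi == Z)%:R * w (shrink phi)].

(** Expansion of the tensor power of C + V by the set of factors taken in C. *)
Lemma sum_embed F : F = \sum_(Z : {set T}) embed Z (restrict F Z).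
Proof.
apply/ffunP => phi; rewrite sum_ffunE (bigD1 (zeros phi)) //= big1 => [|Z nZ].
  by rewrite !ffunE eqxx mul1r shrinkK addr0.
by rewrite ffunE eq_sym (negbTE nZ) mul0r.
Qed.

Definition fixed p : {set T} := [set v | p v == v].

(** What the theorem on V produces: pairs carry nonzero labels only, whereas diagram operators also
    allow the label 0 on pairs. *)
Definition strict_tensor p : W :=
  [ffun phi : idx => ((zeros phi == fixed p) && [forall v, phi (p v) == phi v])%:R].

Definition valid_tensor p : W := [ffun phi : idx => (valid (e0 k) p phi)%:R].

Lemma embed_match Z p : matching (~: Z) p ->
  embed Z (match_tensor C k p) = strict_tensor p.
Proof.
move=> [pK pZ]; apply/ffunP => phi; rewrite !ffunE -natrM mulnb; congr (_%:R).
have -> : fixed p = Z by apply/setP => v; rewrite inE pZ inE negbK.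
congr nat_of_bool; case: eqP => //= zZ; apply: eq_forallb => v.
have pE u : phi u = if u \in Z then e0 k else r1 (shrink phi u).
  by rewrite -{1}(shrinkK phi) zZ ffunE.
rewrite [phi (p v)]pE [phi v]pE.
have [vZ|vZ] := boolP (v \in Z).
  have /eqP-> : p v == v by rewrite pZ inE vZ.
  by rewrite vZ !eqxx.
have -> : (p v \in Z) = false.
  by apply: contraNF vZ => pvZ; have := pZ (p v); rewrite inE pvZ pK eq_sym pZ inE negbK.
by rewrite r1_eq.
Qed.

Definition subinvol q p := [forall v, (q v == v) || (q v == p v)].

(** Exactly one [q] contributes at a valid labelling: the one obtained from [p] by splitting the
    pairs labelled 0. *)
Lemma valid_tensor_sum p : involutive p -> valid_tensor p =
  \sum_(q : {ffun T -> T} | [forall v, q (q v) == v] && subinvol q p) strict_tensor q.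
Proof.
move=> pK; apply/ffunP => phi; rewrite sum_ffunE ffunE.
pose q0 : {ffun T -> T} := [ffun v => if phi v == e0 k then v else p v].
have uniq_q q : subinvol q p -> zeros phi = fixed q -> q = q0.
  move=> /forallP qp /setP zq; apply/ffunP => v; rewrite ffunE.
  have := zq v; rewrite !inE => ->; case: eqP => // qv.
  by have := qp v; rewrite -[q v == v]/(_ == _) => /orP[/eqP//|/eqP].
have [v|nv] := boolP (valid _ _ _); last first.
  rewrite big1 // => q /andP[/forallP qK qp]; rewrite ffunE; case:
    andP => // -[/eqP/setP zq /forallP qphi].
  case/negP: nv; apply/validP; move: qp => /forallP qp.
  have fix0 v : q v = v -> phi v = e0 k by move=> qv; apply/eqP; have := zq v;
    rewrite !inE qv eqxx.
  split=> v => [|pv]; last by apply: fix0; have := qp v; rewrite pv orbb => /eqP.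
  have /orP[/eqP qv|/eqP<-] := qp v; last exact/eqP.
  rewrite (fix0 v qv); apply: fix0; have := qp (p v); rewrite pK => /orP[/eqP//|/eqP qpv].
  by have /eqP := qK (p v); rewrite qpv qv.
have [v1 v2] := validP _ _ _ v.
have z0 : zeros phi = fixed q0.
  apply/setP => u; rewrite !inE ffunE; case: eqP => [_|nz]; first by rewrite eqxx.
  by apply/esym/negbTE/eqP => /v2.
rewrite (bigD1 q0) /=; last first.
  apply/andP; split; apply/forallP => u; rewrite !ffunE; last by case: ifP;
    rewrite eqxx ?orbT.
  by case: (boolP (phi u == e0 k)) => [->//|nz]; rewrite v1 (negbTE nz) pK.
rewrite ffunE z0 eqxx big1 ?addr0 => [|q /andP[/andP[_ qp] nq]].
  case: forallP => // -[] u; rewrite ffunE; case: ifP => // _; by rewrite v1.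
rewrite ffunE; case: andP => // -[/eqP zq _]; case/eqP: nq; exact: uniq_q.
Qed.

(** The previous sum is unitriangular for the number of points moved, since every term other than
    [p] splits some pair; it is inverted by induction. *)
Lemma strict_tensor_span (U : {vspace W}) :
  (forall p, involutive p -> valid_tensor p \in U) ->
  forall p, involutive p -> strict_tensor p \in U.
Proof.
move=> HU p; have [n] := ubnP #|~: fixed p|; elim: n p => // n IHn p ltn pK.
have := valid_tensor_sum pK; rewrite (bigD1 p) /=; last first.
  by apply/andP; split; apply/forallP => v; rewrite ?pK ?eqxx ?orbT.
set S := \sum_(q | _) _ => E.
have -> : strict_tensor p = valid_tensor p - S by rewrite E addrK.
apply: memvB; first exact: HU.
apply: memv_suml => q /andP[/andP[/forallP qK /forallP qp] nq].
apply: IHn => [|v]; last exact/eqP.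
apply: leq_trans (proper_card _) (ltn : (_ <= n)%N); apply/properP; split.
  apply/subsetP => v; rewrite !inE; apply: contraNneq => pv.
  by have := qp v; rewrite pv orbb.
have [v qv] : exists v, q v != p v.
  apply/existsP; apply: contraNT nq => /existsPn H; apply/eqP/ffunP => v.
  by apply/eqP; have := H v; rewrite negbK.
have /eqP qvv : q v == v by have := qp v; rewrite (negbTE qv) orbF.
by exists v; rewrite !inE ?qvv ?eqxx // eq_sym -{1}qvv.
Qed.

Theorem orthogonal_invariant_span F (U : {vspace W}) :
  (forall g, orthogonal g -> tensor_act (Obar g) F = F) ->
  (forall p, involutive p -> valid_tensor p \in U) -> F \in U.
Proof.
move=> Finv HU; rewrite (sum_embed F); apply: memv_suml => Z _.
have := invariant_matching_span (restrict_invariant Z Finv).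
apply: (@matching_span_ind C T k _ (fun w => embed Z w \in U)).
- rewrite (_ : embed Z 0 = 0) ?mem0v //.
  by apply/ffunP => phi; rewrite !ffunE mulr0.
- move=> z x y xU yU; rewrite (_ : embed _ _ = z *:
  embed Z x + embed Z y) ?memvD ?memvZ //.
  by apply/ffunP => phi; rewrite !ffunE mulrDr mulrCA.
- move=> p mp; have [pK pZ] := mp.
  have -> : match_tensor C k p = match_tensor C k [ffun v => p v].
    apply/ffunP => I; rewrite !ffunE; congr (_%:R); congr nat_of_bool.
    by apply: eq_forallb => v; rewrite ffunE.
  have mp' : matching (~: Z) [ffun v => p v] by split=> v; rewrite !ffunE.
  rewrite embed_match //; apply: strict_tensor_span => //; exact: mp'.1.
Qed.

End Restriction.

(** * The commutant of O_k *)

Section OrthogonalAction.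

Variables (C : fieldType) (k m : nat).
Implicit Types (f : tend C k m) (g : 'M[C]_k) (I J K : midx k m).

Lemma tmapM A B : tmap A * tmap B = tmap (fun i => A i *m B i) :> tend C k m.
Proof.
apply: tend_ext => I J; rewrite tendM tmap_pure tmap_pure tmap_entry ffunE.
by apply: eq_bigr => l _; rewrite mulmxA -colE mxE.
Qed.

Lemma tmap1 : tmap (fun=> 1%:M) = 1 :> tend C k m.
Proof.
apply: tend_ext => I J; rewrite tend1 tmap_pure ffunE [RHS]ffunE.
by apply: eq_bigr => l _; rewrite mul1mx.
Qed.

Lemma OactE g : Oact m g = tmap (fun=> Obar g).
Proof. by []. Qed.

Lemma ObarM g h : Obar g *m Obar h = Obar (g *m h).
Proof. by rewrite /Obar mulmx_block !(mulmx1, mul1mx, mulmx0, mul0mx, addr0, add0r). Qed.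

Lemma Obar1 : Obar 1%:M = 1%:M :> 'M[C]_(1 + k).
Proof. by rewrite /Obar -scalar_mx_block. Qed.

Lemma ObarT g : (Obar g)^T = Obar g^T.
Proof. by rewrite /Obar tr_block_mx trmx1 !trmx0. Qed.

Lemma OactM g h : Oact m g * Oact m h = Oact m (g *m h).
Proof. by rewrite !OactE tmapM ObarM. Qed.

Lemma Oact1 : Oact m (1%:M : 'M[C]_k) = 1.
Proof. by rewrite OactE Obar1 tmap1. Qed.

Definition dop_span : {vspace tend C k m} := <<[seq dop C k d | d : diagram m]>>%VS.

Lemma mem_dop_span d : dop C k d \in dop_span.
Proof. by apply: memv_span; apply: image_f. Qed.

Lemma orthogonal_mulT g : orthogonal g -> g *m g^T = 1%:M.
Proof. by move/orthogonalP/mulmx1C. Qed.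

End OrthogonalAction.

Section Commutant.

Variables (C : numClosedFieldType) (k m : nat).

Local Notation idx := {ffun vert m -> 'I_(1 + k)}.
Local Notation W := {ffun idx -> C^o}.
Implicit Types (f : tend C k m) (g : 'M[C]_k) (I J K : midx k m) (phi : idx).

Definition pair_label I J : idx := [ffun v => glue I J v].

Definition top_label phi : midx k m := [ffun i => phi (inl i)].
Definition bot_label phi : midx k m := [ffun i => phi (inr i)].

Lemma top_labelK I J : top_label (pair_label I J) = I.
Proof. by apply/ffunP => i; rewrite !ffunE. Qed.

Lemma bot_labelK I J : bot_label (pair_label I J) = J.
Proof. by apply/ffunP => i; rewrite !ffunE. Qed.

Lemma pair_labelK phi : pair_label (top_label phi) (bot_label phi) = phi.
Proof. by apply/ffunP => -[i|i]; rewrite !ffunE /= ffunE. Qed.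

Definition entries f : W :=
  [ffun phi : idx => f (tbasis C (bot_label phi)) (top_label phi)].

Definition of_entries (x : W) : tend C k m :=
  text (fun J => [ffun I : midx k m => x (pair_label I J)]).

Lemma of_entriesE x I J : of_entries x (tbasis C J) I = x (pair_label I J).
Proof. by rewrite text_basis ffunE. Qed.

Lemma entriesK f : of_entries (entries f) = f.
Proof.
by apply: tend_ext => I J; rewrite of_entriesE ffunE top_labelK bot_labelK.
Qed.

(** For orthogonal [g] the right-hand side is a conjugation, [g^T] being the inverse. So operators
    commuting with O_k become invariant tensors with factors indexed by the vertices of a
    diagram. *)
Lemma tensor_act_entries g f :
  of_entries (tensor_act (Obar g) (entries f)) = Oact m g * f * Oact m g^T.
Proof.
apply: tend_ext => I J; rewrite of_entriesE ffunE tendM_entry.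
under [RHS]eq_bigr do rewrite tendM_entry mulr_suml.
rewrite exchange_big pair_big /=.
rewrite (reindex (fun p : midx k m * midx k m => pair_label p.1 p.2)) /=; last first.
  exists (fun phi => (top_label phi, bot_label phi)) => [[K L] _|phi _] /=.
    by rewrite top_labelK bot_labelK.
  exact: pair_labelK.
apply: eq_bigr => -[K L] _ /=; rewrite ffunE top_labelK bot_labelK !OactE !tmap_entry.
rewrite mulrAC; congr (_ * _).
rewrite big_sumType /=; congr (_ * _); apply: eq_bigr => i _; rewrite !ffunE //=.
by rewrite -ObarT [RHS]mxE.
Qed.

Lemma commutant_dop_span f : (0 < k)%N ->
  (forall g, orthogonal g -> f * Oact m g = Oact m g * f) -> f \in dop_span C k m.
Proof.
move=> k0 cf; pose i0 : 'I_k := Ordinal k0.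
have Finv g : orthogonal g -> tensor_act (Obar g) (entries f) = entries f.
  move=> og; have : of_entries (tensor_act (Obar g) (entries f)) = f.
    by rewrite tensor_act_entries -cf // -mulrA OactM orthogonal_mulT // Oact1 mulr1.
  move=> E; apply/ffunP => phi; rewrite -{1}(pair_labelK phi) -of_entriesE E.
  by rewrite ffunE.
rewrite -(entriesK f).
have : entries f \in <<[seq valid_tensor C k (finfun (partner d)) | d : diagram m]>>%VS.
  apply: (orthogonal_invariant_span i0) => // p pK; apply: memv_span.
  apply/imageP; exists (diagram_of p) => //; apply/ffunP => phi; rewrite !ffunE.
  congr (_%:R); congr nat_of_bool; apply: eq_valid => // v.
  by rewrite ffunE partner_diagram_of.
apply: (@span_ind _ _ (fun x => of_entries x \in dop_span C k m)).
- rewrite (_ : of_entries 0 = 0) ?mem0v //; apply: tend_ext => I J.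
  by rewrite of_entriesE -[0 in RHS](scale0r (1 : tend C k m)) tendZ_entry mul0r ffunE.
- move=> a x y xU yU; rewrite (_ : of_entries _ = a *:
  of_entries x + of_entries y) ?memvD ?memvZ //.
  apply: tend_ext => I J; rewrite tendD_entry tendZ_entry !of_entriesE.
  by rewrite !ffunE.
- move=> _ /imageP[d _ ->]; rewrite (_ : of_entries _ = dop C k d) ?mem_dop_span //.
  apply: tend_ext => I J; rewrite of_entriesE dop_entry ffunE; congr (_%:R).
  by congr nat_of_bool; apply: eq_valid => v; rewrite ffunE.
Qed.

End Commutant.

(** * The double commutant *)

(** The infinite set [S] is replaced by a list, enlarged as long as some value escapes its span; [n]
    bounds the remaining codimension. *)
Lemma finite_span_family (K : fieldType) (V : vectType K) (G : eqType)
    (h : G -> V) (S : G -> Prop) :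
  exists2 gs : seq G, (forall g, g \in gs -> S g) &
    forall g, S g -> h g \in <<map h gs>>%VS.
Proof.
suff H n (gs : seq G) : (forall g, g \in gs -> S g) ->
    (\dim (fullv : {vspace V}) <= \dim <<map h gs>> + n)%N ->
    exists2 gs : seq G, (forall g, g \in gs -> S g) &
      forall g, S g -> h g \in <<map h gs>>%VS.
  by apply: (H (\dim (fullv : {vspace V})) [::]) => //; exact: leq_addl.
elim: n gs => [|n IHn] gs Sgs dn.
  exists gs => // g _; have /eqP-> : <<map h gs>>%VS == fullv.
    by rewrite eqEdim subvf; rewrite addn0 in dn.
  exact: memvf.
have [ok|] := pselect (forall g, S g -> h g \in <<map h gs>>%VS); first by exists gs.
move=> /existsNP[g /not_implyP[Sg /negP ng]]; apply: (IHn (g :: gs)).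
  by move=> g'; rewrite inE => /orP[/eqP->|/Sgs].
apply: leq_trans dn _; rewrite addnS -addSn leq_add2r /= span_cons.
rewrite ltnNge; apply: contraNN ng => le.
have /eqP-> : <<map h gs>>%VS == (<[h g]> + <<map h gs>>)%VS by rewrite eqEdim addvSr.
exact: (subvP (addvSl _ _)) (memv_line _).
Qed.

Section DoubleCommutant.

Variables (C : numClosedFieldType) (k m : nat).

Local Notation idx := {ffun vert m -> 'I_(1 + k)}.
Local Notation W := {ffun idx -> C^o}.
Implicit Types (f a : tend C k m) (g : 'M[C]_k) (I J K L : midx k m) (phi :
  idx) (x y u : W).

Lemma of_entries_linear z x y :
  of_entries (z *: x + y) = z *: of_entries x + of_entries y :> tend C k m.
Proof.
apply: tend_ext => I J; rewrite tendD_entry tendZ_entry !of_entriesE.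
by rewrite !ffunE.
Qed.

Lemma of_entries0 : of_entries 0 = 0 :> tend C k m.
Proof.
have := of_entries_linear (-1) 0 0; rewrite scaler0 addr0 => ->.
by rewrite scaleN1r addNr.
Qed.

Lemma entriesE f I J : entries f (pair_label I J) = f (tbasis C J) I.
Proof. by rewrite ffunE top_labelK bot_labelK. Qed.

Lemma of_entriesK x : entries (of_entries x) = x.
Proof. by apply/ffunP => phi; rewrite ffunE of_entriesE pair_labelK. Qed.

Lemma sum_pair_label (G : idx -> C) :
  \sum_phi G phi = \sum_I \sum_J G (pair_label I J).
Proof.
rewrite pair_big /= (reindex (fun p : midx k m * midx k m => pair_label p.1 p.2)) //=.
exists (fun phi => (top_label phi, bot_label phi)) => [[K L] _|phi _] /=.
  by rewrite top_labelK bot_labelK.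
exact: pair_labelK.
Qed.

Lemma eq_pair_label x y :
  (forall I J, x (pair_label I J) = y (pair_label I J)) -> x = y.
Proof. by move=> H; apply/ffunP => phi; rewrite -(pair_labelK phi). Qed.

(** Left multiplication on endomorphisms, transported to the coordinate space that carries [dot]. *)
Definition lmult a x : W := entries (a * of_entries x).

Lemma lmultE a x I J :
  lmult a x (pair_label I J) = \sum_K a (tbasis C K) I * x (pair_label K J).
Proof. by rewrite entriesE tendM_entry; apply: eq_bigr => K _; rewrite of_entriesE. Qed.

Lemma lmult_linear a z x y : lmult a (z *: x + y) = z *: lmult a x + lmult a y.
Proof.
apply: eq_pair_label => I J; rewrite [RHS]ffunE [(_ *: lmult _ _) _]ffunE !lmultE.
rewrite [X in _ = X + _]mulr_sumr -big_split; apply: eq_bigr => K _.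
by rewrite !ffunE mulrDr mulrCA.
Qed.

Definition unit_tensor phi : W := [ffun psi : idx => (psi == phi)%:R].

Lemma unit_tensor_sum x : x = \sum_phi x phi *: unit_tensor phi.
Proof.
apply/ffunP => psi; rewrite sum_ffunE (bigD1 psi) //= big1 ?addr0 => [|phi np].
  by rewrite !ffunE eqxx [_ *: _]mulr1.
by rewrite !ffunE eq_sym (negbTE np) [_ *: _]mulr0.
Qed.

Lemma pair_label_eq I J K L :
  (pair_label I J == pair_label K L :> idx) = (I == K) && (J == L).
Proof.
apply/eqP/andP => [E|[/eqP-> /eqP->]] //.
split; apply/eqP; first by rewrite -(top_labelK I J) E top_labelK.
by rewrite -(bot_labelK I J) E bot_labelK.
Qed.

Lemma lmult_unit a K J : lmult a (unit_tensor (pair_label K J)) =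
  \sum_L a (tbasis C K) L *: unit_tensor (pair_label L J).
Proof.
apply: eq_pair_label => I J'; rewrite lmultE sum_ffunE (bigD1 K) //= big1 => [|L nL].
  rewrite (bigD1 I) //= big1 => [|L nL].
    by rewrite !ffunE !pair_label_eq !eqxx.
  by rewrite !ffunE pair_label_eq eq_sym (negbTE nL) [_ *: _]mulr0.
by rewrite ffunE pair_label_eq (negbTE nL) mulr0.
Qed.

Section Blocks.

Variable P : 'End(W).

Definition block J J0 : tend C k m :=
  text (fun K => [ffun I :
    midx k m => P (unit_tensor (pair_label K J0)) (pair_label I J)]).

(** Left multiplication acts on each column of a matrix separately: the space of matrices is a sum
    of copies of the tensor space indexed by columns, with [a] acting diagonally, and [block J J0]
    is the component of [P] from copy [J0] to copy [J]. *)
Lemma block_commP a :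
  (forall x, P (lmult a x) = lmult a (P x)) <->
  (forall J J0, a * block J J0 = block J J0 * a).
Proof.
have bE J J0 K I :
  block J J0 (tbasis C K) I = P (unit_tensor (pair_label K J0)) (pair_label I J).
  by rewrite text_basis ffunE.
have lE J J0 I K : (a * block J J0) (tbasis C K) I =
    lmult a (P (unit_tensor (pair_label K J0))) (pair_label I J).
  by rewrite tendM_entry lmultE; apply: eq_bigr => L _; rewrite bE.
have rE J J0 I K : (block J J0 * a) (tbasis C K) I =
    P (lmult a (unit_tensor (pair_label K J0))) (pair_label I J).
  rewrite tendM_entry lmult_unit linear_sum sum_ffunE; apply: eq_bigr => L _.
  by rewrite bE linearZ ffunE mulrC.
split=> H.
  by move=> J J0; apply: tend_ext => I K; rewrite lE rE H.
have Hu phi : P (lmult a (unit_tensor phi)) = lmult a (P (unit_tensor phi)).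
  rewrite -(pair_labelK phi); apply: eq_pair_label => I J.
  by rewrite -rE -lE H.
move=> x; rewrite (unit_tensor_sum x).
elim/big_rec: _ => [|phi y _ IH].
  have l0 : lmult a 0 = 0
    by rewrite -[0 in LHS](addr0) -[X in X + _](scaler0 _ (-1)) lmult_linear scaleN1r addNr.
  by rewrite l0 linear0 l0.
by rewrite lmult_linear !linearP /= lmult_linear Hu IH.
Qed.

End Blocks.

Definition adjoint_mx g : 'M[C]_k := (map_mx Num.conj g)^T.

(** A complex orthogonal matrix need not be unitary, but conjugation is a field automorphism and
    respects the equations g^T g = g g^T = 1. *)
Lemma orthogonal_adjoint g : orthogonal g -> orthogonal (adjoint_mx g).
Proof.
move=> og; apply/orthogonalP; rewrite /adjoint_mx trmxK map_trmx -map_mxM.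
by rewrite orthogonal_mulT // map_mx1.
Qed.

Lemma Oact_entry g I J : Oact m g (tbasis C J) I = \prod_l Obar g (I l) (J l).
Proof. by rewrite OactE tmap_entry. Qed.

Lemma Oact_adjoint_entry g I J :
  Oact m (adjoint_mx g) (tbasis C J) I = (Oact m g (tbasis C I) J)^*.
Proof.
rewrite !Oact_entry rmorph_prod; apply: eq_bigr => l _.
rewrite -ObarT [LHS]mxE /=.
have [E1 E2 E3 E4] := ObarE g; have [F1 F2 F3 F4] := ObarE (map_mx Num.conj g).
case: (labelP (I l)) => [->|i ->]; case: (labelP (J l)) => [->|j ->].
- by rewrite E1 F1 rmorph1.
- by rewrite E3 F3 rmorph0.
- by rewrite E2 F2 rmorph0.
- by rewrite E4 F4 mxE.
Qed.

Lemma dot_lmult g y u :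
  dot (lmult (Oact m g) y) u = dot y (lmult (Oact m (adjoint_mx g)) u).
Proof.
rewrite /dot !sum_pair_label exchange_big [RHS]exchange_big; apply: eq_bigr => J _ /=.
under eq_bigr do rewrite lmultE mulr_suml.
under [RHS]eq_bigr do rewrite lmultE rmorph_sum mulr_sumr.
rewrite exchange_big; apply: eq_bigr => K _; apply: eq_bigr => I _ /=.
rewrite (Oact_adjoint_entry g K I) -mulrA mulrCA; congr (_ * _).
by rewrite rmorphM; congr (_ * _); apply/esym/conjCK.
Qed.

Lemma proj_fixed (s : seq W) (P : 'End(W)) :
  (forall x, P x \in <<s>>%VS /\ forall u, u \in <<s>>%VS -> dot (x - P x) u = 0) ->
  forall x y, y \in <<s>>%VS -> (forall u, u \in <<s>>%VS -> dot (x - y) u = 0) ->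
    P x = y.
Proof.
move=> HP x y ys xy; have [Px xo] := HP x; apply/eqP; rewrite -subr_eq0; apply/eqP.
have ds : P x - y \in <<s>>%VS by rewrite memvB.
have E : P x - y = (-1) *: (x - P x) + (x - y).
  by rewrite scaleN1r opprB addrA subrK.
by apply: dot_eq0; rewrite {1}E dotDl xo // xy // mulr0 addr0.
Qed.

Lemma double_commutant f :
  (forall a, (forall g, orthogonal g -> a * Oact m g = Oact m g * a) -> f * a = a * f) ->
  in_Ospan f.
Proof.
move=> Hf; have [gs ogs full] := finite_span_family (@Oact C k m) (@orthogonal C k).
set U' := <<_>>%VS in full.
suff fU : f \in U'.
  exists (size gs), (fun i => coord [tuple of [seq Oact m g | g <- in_tuple gs]] i f), (fun i => gs`_i).
  split=> [i|]; first by apply/ogs/mem_nth.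
  rewrite {1}(coord_span (X := [tuple of [seq Oact m g | g <- in_tuple gs]]) fU).
  by apply: eq_bigr => i _; congr (_ *: _); rewrite (nth_map 0).
pose s := [seq entries (Oact m g) | g <- gs].
have sU x : x \in <<s>>%VS -> of_entries x \in U'.
  apply: (@span_ind _ _ (fun x => of_entries x \in U')).
  - by rewrite of_entries0 mem0v.
  - by move=> z y t yU tU; rewrite of_entries_linear memvD ?memvZ.
  - move=> _ /mapP[g gg ->]; rewrite entriesK; apply: memv_span; exact: map_f.
have Us a : a \in U' -> entries a \in <<s>>%VS.
  apply: (@span_ind _ _ (fun a => entries a \in <<s>>%VS)).
  - by rewrite -of_entries0 of_entriesK mem0v.
  - move=> z b c bU cU;
    rewrite -(entriesK b) -(entriesK c) -of_entries_linear of_entriesK.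
    by rewrite memvD ?memvZ.
  - move=> _ /mapP[g gg ->]; apply: memv_span; exact:
    (map_f (fun g => entries (Oact m g))).
have stable g x : orthogonal g -> x \in <<s>>%VS -> lmult (Oact m g) x \in <<s>>%VS.
  move=> og; apply: (@span_ind _ _ (fun x => lmult (Oact m g) x \in <<s>>%VS)).
  - by rewrite /lmult of_entries0 mulr0 -of_entries0 of_entriesK mem0v.
  - by move=> z y t yU tU; rewrite lmult_linear memvD ?memvZ.
  - move=> _ /mapP[h hh ->]; apply: Us; rewrite entriesK OactM; apply: full.
    apply/orthogonalP; rewrite trmx_mul mulmxA -(mulmxA _ g^T).
    have /orthogonalP-> := og; rewrite mulmx1.
    exact/orthogonalP/ogs.
have [P HP] := orth_proj s.
(* The span is stable under [g], and its orthogonal complement as well since the span is stable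
   under the adjoint of [g]. *)
have PO g : orthogonal g -> forall x, P (lmult (Oact m g) x) = lmult (Oact m g) (P x).
  move=> og x; have [Px xo] := HP x; apply: (proj_fixed HP) => [|u us]; first exact:
    stable.
  have -> : lmult (Oact m g) x - lmult (Oact m g) (P x) = lmult (Oact m g) (x - P x).
    by rewrite addrC -scaleN1r -lmult_linear scaleN1r addrC.
  by rewrite dot_lmult xo //; apply: stable => //; apply: orthogonal_adjoint.
have Pf : forall x, P (lmult f x) = lmult f (P x).
  apply/block_commP => J J0; apply: Hf => g og.
  by apply/esym; move: J J0; apply/block_commP/PO.
have one : entries (1 : tend C k m) \in <<s>>%VS.
  by apply: Us; rewrite -Oact1; apply: full => u v; rewrite !mul1mx.
have P1 : P (entries 1) = entries 1.
  by apply: (proj_fixed HP) => // u _; rewrite subrr dot0l.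
(* The identity lies in the span, so P(f) = f P(1) = f, which puts [f] in the span. *)
have := Pf (entries 1); rewrite P1 /lmult entriesK mulr1 => E.
by rewrite -(entriesK f) sU // -E; have [] := HP (entries f).
Qed.

End DoubleCommutant.

(** * The algebra R_m commutes with O_k *)

Section GeneratorsCommute.

Variables (C : fieldType) (k m : nat).
Implicit Types (I J K : midx k m).

Lemma Sact_tmap_comm (h : 'M[C]_(1 + k)) s :
  Sact C k s * tmap (fun=> h) = tmap (fun=> h) * Sact C k s :> tend C k m.
Proof.
by apply: tend_ext => I J; rewrite !tendM tmap_pure !Sact_pure tmap_pure.
Qed.

(* Only the multi-indices constant on [{i, j}] and equal to [I] elsewhere
   contribute. *)
Lemma sum_valid_p (h : 'M[C]_(1 + k)) (i j : 'I_m) I J : i != j -> h^T *m h = 1%:M ->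
  \sum_(K : midx k m) (valid (e0 k) (partner (p_diag i j)) (glue I K))%:R * (\prod_l h (K l) (J l)) =
  (I i == I j)%:R * (J i == J j)%:R * \prod_(l | (l != i) && (l != j)) h (I l) (J l).
Proof.
move=> ij hh; have ji : j != i by rewrite eq_sym.
have [Iij|nI] := eqVneq (I i) (I j); last first.
  rewrite mul0r mul0r big1 // => K _.
  case: (valid_pP _ _ _ ij) => [[Iij _ _]|_]; last by rewrite mul0r.
  by rewrite Iij eqxx in nI.
pose U (s : 'I_(1 + k)) : midx k m := upd (upd I i s) j s.
transitivity (\sum_(K :
  midx k m | valid (e0 k) (partner (p_diag i j)) (glue I K)) \prod_l h (K l) (J l)).
  by rewrite [RHS]big_mkcond; apply: eq_bigr => K _; case: ifP; rewrite ?mul1r ?mul0r.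
have Ui s : U s i = s by rewrite upd_off // upd_at.
have Uj s : U s j = s by rewrite upd_at.
have Ul s l : l != i -> l != j -> U s l = I l by move=> li lj; rewrite !upd_off.
rewrite (reindex_onto U (fun K => K i)) => [|K /(valid_pP _ _ _ ij)[_ Kij IK]];
  last first.
  apply/ffunP => l; have [->|li] := eqVneq l i; first by rewrite Ui.
  have [->|lj] := eqVneq l j; first by rewrite Uj.
  by rewrite Ul // IK.
rewrite mul1r (eq_bigl predT) => [|s]; last first.
  rewrite Ui eqxx andbT; apply/(valid_pP _ _ _ ij); split=> // [|l li lj].
    by rewrite Ui Uj.
  by rewrite Ul.
have /matrixP/(_ (J i) (J j)) := hh; rewrite !mxE => <-.
rewrite mulr_suml; apply: eq_bigr => s _.
rewrite (bigD1 i) //= (bigD1 j) //= Ui Uj mxE mulrA; congr (_ * _).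
by apply: eq_bigr => l /andP[li lj]; rewrite Ul.
Qed.

(** As [zeta] is a symmetric matrix, transposing turns one side into the other with [h^T] for [h]
    and [I], [J] exchanged; [sum_valid_p] evaluates both. *)
Lemma zeta_tmap_comm (h : 'M[C]_(1 + k)) (i j : 'I_m) : i != j -> h^T *m h = 1%:M ->
  zeta C k i j * tmap (fun=> h) = tmap (fun=> h) * zeta C k i j.
Proof.
move=> ij hh; rewrite -!dop_p //; apply: tend_ext => I J; rewrite !tendM_entry.
under eq_bigr do rewrite dop_entry tmap_entry.
rewrite sum_valid_p //.
have hh' : h^T^T *m h^T = 1%:M by rewrite trmxK; apply: mulmx1C.
transitivity (\sum_(K : midx k m) (valid (e0 k) (partner (p_diag i j)) (glue J K))%:R *
    (\prod_l h^T (K l) (I l))).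
  rewrite sum_valid_p // [X in X * _]mulrC; congr (_ * _).
  by apply: eq_bigr => l _; rewrite mxE.
apply: eq_bigr => K _; rewrite dop_entry tmap_entry mulrC; congr (_ * _).
  by apply: eq_bigr => l _; rewrite mxE.
congr (_%:R); congr nat_of_bool.
by apply/(valid_pP _ _ _ ij)/(valid_pP _ _ _ ij) => -[H1 H2 H3]; split=> // l li lj;
  rewrite H3.
Qed.

Lemma Ralg_Oact_comm (g : 'M[C]_k) f : orthogonal g -> f \in Ralg C k m ->
  f * Oact m g = Oact m g * f.
Proof.
move=> og fR; apply/cent1vP; move: f fR; apply/subvP.
have gens : (<<Rgens C k m>> <= 'C[Oact m g])%VS.
  apply/span_subvP => a; rewrite !mem_cat => /or3P[].
  - by case/imageP=> s _ ->; apply/cent1vP/Sact_tmap_comm.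
  - case/imageP=> i _ ->; apply/cent1vP; rewrite /eps OactE !tmapM.
    apply: tend_ext => I J; rewrite !tmap_entry; apply: eq_bigr => l _.
    case: ifP => _; last by rewrite mulmx1 mul1mx.
    by rewrite /Obar !mulmx_block !(mulmx1, mul1mx, mulmx0, mul0mx, addr0, add0r).
  - case/mapP=> -[i j]; rewrite mem_filter /= => /andP[ij _] ->.
    apply/cent1vP/zeta_tmap_comm; first by rewrite -val_eqE /= -(eqP ij); lia.
    by rewrite ObarT ObarM (orthogonalP g).1 // Obar1.
apply: agenv_sub_modl; first by apply/subvP => a /vlineP[c ->]; rewrite memvZ // cent1v1.
by apply: subv_trans (prodvSl _ gens) _; rewrite prodv_id.
Qed.

End GeneratorsCommute.

(** * The algebra R_m is the span of the diagram operators *)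

Section Image.

Variables (C : numFieldType) (k m : nat).

Lemma Rgens_Ralg a : a \in Rgens C k m -> a \in Ralg C k m.
Proof. by move=> aR; apply: (subvP (sub_agenv _)); apply: memv_span. Qed.

(** The power of k + 1 in a product of two diagram operators is nonzero in characteristic 0 and can
    be divided out. *)
Lemma dop_Ralg d : dop C k d \in Ralg C k m.
Proof.
move: d; apply: diagram_ind => [s|i|i j ij|d d' dR d'R].
- by rewrite dop_perm; apply: Rgens_Ralg; rewrite !mem_cat; apply/or3P/Or31/image_f.
- by rewrite dop_u; apply: Rgens_Ralg; rewrite !mem_cat; apply/or3P/Or32/image_f.
- rewrite dop_p; last by rewrite -val_eqE /= -ij; lia.
  apply: Rgens_Ralg; rewrite !mem_cat; apply/or3P; apply: Or33; apply/mapP.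
  by exists (i, j); rewrite // mem_filter /= ij eqxx mem_enum.
- have := memv_mul dR d'R; rewrite prodv_id dop_mul; set c := _ ^+ _ => cR.
  have c0 : c != 0 by rewrite expf_neq0 // pnatr_eq0.
  by rewrite -[dop _ _ (comp d d')]scale1r -(mulVf c0) -scalerA memvZ.
Qed.

Lemma dop_span_Ralg : dop_span C k m = Ralg C k m.
Proof.
apply/eqP; rewrite eqEsubv; apply/andP; split.
  by apply/span_subvP => _ /imageP[d _ ->]; apply: dop_Ralg.
apply: agenv_sub_modl.
  apply/subvP => a /vlineP[c ->]; rewrite memvZ // -dop1; exact: mem_dop_span.
have gens : (<<Rgens C k m>> <= dop_span C k m)%VS.
  apply/span_subvP => a; rewrite !mem_cat => /or3P[].
  - by case/imageP=> s _ ->; rewrite -dop_perm mem_dop_span.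
  - by case/imageP=> i _ ->; rewrite -dop_u mem_dop_span.
  - case/mapP=> -[i j]; rewrite mem_filter /= => /andP[ij _] ->.
    by rewrite -dop_p ?mem_dop_span // -val_eqE /= -(eqP ij); lia.
apply: subv_trans (prodvSl _ gens) _; apply/prodvP => a b aD bD.
move: a aD; apply: (@span_ind _ _ (fun a => a * b \in dop_span C k m)).
- by rewrite mul0r mem0v.
- by move=> c x y xD yD; rewrite mulrDl -scalerAl memvD ?memvZ.
- move=> _ /imageP[d _ ->]; move: b bD.
  apply: (@span_ind _ _ (fun b => dop C k d * b \in dop_span C k m)).
  + by rewrite mulr0 mem0v.
  + by move=> c x y xD yD; rewrite mulrDr -scalerAr memvD ?memvZ.
  + by move=> _ /imageP[d' _ ->]; rewrite dop_mul memvZ ?mem_dop_span.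
Qed.

End Image.

(** * The homomorphism *)

Section Independence.

Variables (C : fieldType) (k m : nat).
Implicit Types (d : diagram m) (I J : midx k m).

(** The 2 m vertices form at most m pair parts, so k >= m nonzero labels can be given injectively to
    them, by their rank in [enum B]. *)
Lemma generic_label d : (0 < k)%N -> (m <= k)%N ->
  exists phi : vert m -> 'I_(1 + k), valid (e0 k) (partner d) phi /\
    forall v w, partner d v != v -> phi v != e0 k /\
      (phi w = phi v -> w \in [set v; partner d v]).
Proof.
move=> k0 mk; pose i0 : 'I_k := Ordinal k0.
pose B := [set A in val d | #|A| == 2].
have szB : (#|B| <= k)%N.
  apply: leq_trans mk; rewrite -(leq_pmul2r (isT : 0 < 2)%N).
  have dB : (#|B| * 2 = #|cover B|)%N.
    have /eqP<- : trivIset B.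
      apply/trivIsetP => A A'; rewrite !inE => /andP[dA _] /andP[dA' _] AA'.
      apply: contraNT AA' => /pred0Pn[v /andP[Av A'v]].
      by rewrite (diagram_eq dA dA' Av A'v).
    by rewrite -sum_nat_const; apply: eq_bigr => A; rewrite inE => /andP[_ /eqP].
  by rewrite dB; apply: leq_trans (max_card _) _; rewrite card_sum card_ord; lia.
pose blk v := [set v; partner d v].
have blkB v : partner d v != v -> blk v \in B.
  by move=> nv; rewrite inE partner_in cards2 [v == _]eq_sym nv.
pose phi v : 'I_(1 + k) :=
  if partner d v == v then e0 k else r1 (insubd i0 (index (blk v) (enum B))).
have blkp v : blk (partner d v) = blk v by rewrite /blk partnerK setUC.
exists phi; split.
  apply/validP; split=> v; last by rewrite /phi => ->; rewrite eqxx.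
  by rewrite /phi blkp (inj_eq (inv_inj (@partnerK _ d))).
move=> v w nv; split; first by rewrite /phi (negbTE nv) r1_e0.
rewrite /phi (negbTE nv); case: ifPn => [_ /eqP|nw]; first by rewrite e0_r1.
have ltk u : partner d u != u -> (index (blk u) (enum B) < k)%N.
  by move=> /blkB uB; apply: leq_trans szB; rewrite cardE index_mem mem_enum.
move/r1_inj/(congr1 val); rewrite !val_insubd !ltk //.
move/(congr1 (nth set0 (enum B))); rewrite !nth_index ?mem_enum ?blkB //.
by rewrite -/(blk v) => <-; rewrite set21.
Qed.

(** Among the diagrams with nonzero coefficient, take [d] with the most vertices in pairs. If its
    generic labelling is valid for another such [d'], then every pair of [d] is a pair of [d'], and
    maximality gives d' = d; so this matrix entry isolates [c d]. *)
Lemma dop_free (c : diagram m -> C) : (0 < k)%N -> (m <= k)%N ->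
  \sum_d c d *: dop C k d = 0 -> forall d, c d = 0.
Proof.
move=> k0 mk H d1; apply: contraTeq isT => nz1.
pose sz d := #|[set v | partner d v != v]|.
case: (@arg_maxnP _ d1 (fun d => c d != 0) sz nz1) => d nz maxd.
have [phi [vphi sep]] := generic_label d k0 mk.
pose I : midx k m := [ffun i => phi (inl i)].
pose J : midx k m := [ffun i => phi (inr i)].
have gE : glue I J =1 phi by case=> i; rewrite /= ffunE.
have := congr1 (fun f : tend C k m => f (tbasis C J) I) H.
rewrite /= tend_sum_entry (bigD1 d) //= tendZ_entry dop_entry.
rewrite (eq_valid _ (frefl _) gE) vphi mulr1 big1 ?addr0 => [E|d' nd].
  case/eqP: nz; rewrite E -[0 in LHS](scale0r (1 : tend C k m)).
  by rewrite tendZ_entry mul0r.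
rewrite tendZ_entry dop_entry (eq_valid _ (frefl _) gE).
have [->|nz'] := eqVneq (c d') 0; first by rewrite mul0r.
rewrite [valid _ _ _](_ : _ = false) ?mulr0 //; apply: contraNF nd => /validP[v1 v2].
have sub v : partner d v != v -> partner d' v = partner d v.
  move=> nv; have [ne w] := sep v (partner d' v) nv.
  have /set2P[pv|//] := w (v1 v); case/eqP: ne; exact: v2.
have fE : [set v | partner d v != v] = [set v | partner d' v != v].
  apply/eqP; rewrite eqEcard; apply/andP; split; last exact: (maxd d' nz').
  by apply/subsetP => v; rewrite !inE => nv; rewrite sub.
apply/eqP/partner_inj => v; have := congr1 (fun A : {set vert m} => v \in A) fE.
rewrite !inE; case: (boolP (partner d v == v)) => [/eqP->|nv _]; last exact: sub.
by move=> /esym/negbT; rewrite negbK => /eqP.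
Qed.

End Independence.

Section Homomorphism.

Variables (C : numFieldType) (k m : nat).

Local Notation A := (subvs_of (Ralg C k m)).
Implicit Types (d : diagram m) (x y : pbrauer C m).

Lemma pbrauer_sum x : x = \sum_d x d *: pbasis C d.
Proof.
apply/ffunP => d; rewrite sum_ffunE (bigD1 d) //= big1 ?addr0 => [|d' nd].
  by rewrite !ffunE eqxx [_ *: _]mulr1.
by rewrite !ffunE eq_sym (negbTE nd) [_ *: _]mulr0.
Qed.

Definition psi_fun x : A := \sum_d x d *: vsproj (Ralg C k m) (dop C k d).

Fact psi_fun_linear : linear psi_fun.
Proof.
move=> a x y; rewrite /psi_fun scaler_sumr -big_split /=.
by apply: eq_bigr => d _; rewrite !ffunE scalerDl scalerA.
Qed.

Lemma psi_exists : exists Psi : 'Hom(pbrauer C m, A), Psi =1 psi_fun.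
Proof.
pose P : {linear pbrauer C m -> A} :=
  HB.pack psi_fun (GRing.isLinear.Build C (pbrauer C m) A _ psi_fun psi_fun_linear).
by exists (linfun P) => x; rewrite lfunE.
Qed.

Lemma vsval_psi x : vsval (psi_fun x) = \sum_d x d *: dop C k d.
Proof.
rewrite /psi_fun linear_sum; apply: eq_bigr => d _.
by rewrite linearZ /= vsprojK // dop_Ralg.
Qed.

Lemma psi_basis d : vsval (psi_fun (pbasis C d)) = dop C k d.
Proof.
rewrite vsval_psi (bigD1 d) //= big1 ?addr0 => [|d' nd]; rewrite ffunE.
  by rewrite eqxx scale1r.
by rewrite (negbTE nd) scale0r.
Qed.

Lemma vsval1 : vsval (1 : A) = 1.
Proof.
by apply/eqP; rewrite algid_eq1 -dop1 dop_Ralg.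
Qed.

Lemma psi_mul x y :
  psi_fun (pbmul k.+1%:R 1 x y) = psi_fun x * psi_fun y.
Proof.
have Psi_lin a u v : psi_fun (a *: u + v) = a *: psi_fun u + psi_fun v by exact:
  psi_fun_linear.
have Psi_sum (I : finType) (F : I -> pbrauer C m) : psi_fun (\sum_i F i) =
  \sum_i psi_fun (F i).
  elim/big_rec2: _ => [|i y1 y2 _ <-]; last by rewrite -[F i]scale1r Psi_lin !scale1r.
  by rewrite /psi_fun big1 // => d _; rewrite ffunE scale0r.
have Psi_scale a u : psi_fun (a *: u) = a *: psi_fun u.
  rewrite -[a *: u]addr0 Psi_lin -[X in _ + X](_ : 0 = _) ?addr0 //.
  by rewrite /psi_fun big1 // => d _; rewrite ffunE scale0r.
apply: val_inj; rewrite /pbmul Psi_sum /= !vsval_psi mulr_suml linear_sum /=.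
apply: eq_bigr => d _; rewrite Psi_sum linear_sum mulr_sumr /=; apply: eq_bigr => d' _.
rewrite Psi_scale linearZ /= psi_basis expr1n mulr1 -scalerA -dop_mul.
by rewrite -scalerAl -scalerAr scalerA.
Qed.

Lemma psi1 : psi_fun (pbone C m) = 1.
Proof. by apply: val_inj; rewrite /= psi_basis dop1 -vsval1. Qed.

(** Uniqueness of Psi: multiplicativity fixes [F] on a composite only up to the loop factor, which
    is nonzero and cancels. *)
Lemma hom_on_diagrams (F : 'Hom(pbrauer C m, A)) :
  Psi_on_generators F -> pb_hom k.+1%:R 1 F -> forall x, F x = psi_fun x.
Proof.
move=> [Fs Fu Fp] [F1 FM].
have Fd d : vsval (F (pbasis C d)) = dop C k d.
  move: d; apply: diagram_ind => [s|i|i j ij|d d' IH IH'].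
  - by rewrite Fs dop_perm.
  - by rewrite Fu dop_u.
  - by rewrite Fp // dop_p // -val_eqE /= -ij; lia.
  - have c0 : k.+1%:R ^+ nb_loops d d' != 0 :> C by rewrite expf_neq0 // pnatr_eq0.
    apply: (scalerI c0); rewrite -dop_mul -IH -IH'.
    have := FM (pbasis C d) (pbasis C d').
    rewrite pbmul_basis expr1n mulr1 linearZ => /(congr1 vsval).
    by rewrite linearZ.
move=> x; apply: val_inj; rewrite /= vsval_psi {1}(pbrauer_sum x) !linear_sum /=.
by apply: eq_bigr => d _; rewrite !linearZ /= Fd.
Qed.

End Homomorphism.

Local Open Scope complex_scope.

Theorem theorem21 (R : realType) (k m : nat) (k_gt0 : (0 < k)%N)
    (m_gt0 : (0 < m)%N) :
  (forall f : tend R[i] k m, in_Ospan f <-> f \in 'C(Ralg R[i] k m)%VS) /\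
  (exists Psi : 'Hom(pbrauer R[i] m, subvs_of (Ralg R[i] k m)),
     [/\ unique (fun F : 'Hom(pbrauer R[i] m, subvs_of (Ralg R[i] k m)) =>
                  Psi_on_generators F /\ pb_hom (k.+1)%:R 1 F) Psi,
         forall f : subvs_of (Ralg R[i] k m), exists x, Psi x = f
       & (m <= k)%N -> injective Psi /\ bijective Psi]).
Proof.
split=> [f|].
  split=> [[n [a [g [og ->]]]]|/centvP fR].
    apply: memv_suml => i _; apply: memvZ; apply/centvP => h hR.
    by apply/esym/Ralg_Oact_comm.
  (* By the fundamental theorem an operator commuting with O_k lies in R_m, so [f] commutes with
     it. *)
  apply: double_commutant => a acomm; apply: fR; rewrite -dop_span_Ralg.
  exact: commutant_dop_span.
have [Psi PsiE] := psi_exists R[i] k m; exists Psi.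
have surj f : exists x, Psi x = f.
  have : vsval f \in dop_span R[i] k m by rewrite dop_span_Ralg; apply: subvsP.
  have : forall a, a \in dop_span R[i] k m -> exists x, vsval (Psi x) = a.
    apply: span_ind => [|c x y [u <-] [v <-]|_ /imageP[d _ ->]].
    - by exists 0; rewrite linear0.
    - by exists (c *: u + v); rewrite !linearP.
    - by exists (pbasis R[i] d); rewrite PsiE psi_basis.
  by move=> H /H[x xf]; exists x; apply: val_inj.
split=> // [|mk].
  split=> [|F [Fg Fh]]; last by apply/lfunP => x; rewrite PsiE (hom_on_diagrams Fg Fh).
  split; last by split=> [|x y]; rewrite !PsiE ?psi1 ?psi_mul.
  split=> [s|i|i j ij]; rewrite PsiE psi_basis.
  - exact: dop_perm.
  - exact: dop_u.
  - by rewrite dop_p // -val_eqE /= -ij neq_ltn ltnSn.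
have inj : injective Psi.
  apply/lker0P/eqP/vspaceP => x; rewrite memv_ker memv0; apply/eqP/eqP => [x0|->];
    last exact: linear0.
  apply/ffunP => d; rewrite ffunE; apply: (dop_free k_gt0 mk).
  by rewrite -vsval_psi -PsiE x0 linear0.
(* The inverse map is chosen among preimages; injectivity makes it two-sided. *)
split=> //; have /choice[h hK] := surj.
by exists h => x //; apply: inj; rewrite hK.
Qed.
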